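(* Let $(M,J,\theta)$ be a pseudohermitian $(2n+1)$-manifold of vanishing torsion such that $$2\,Ric(Z,Z)\ge-k\,\langle Z,Z\rangle\qquad\text{for all } Z\in\Gamma(T_{1,0}M),$$ where $k\ge0$. Then $M$ satisfies the curvature-dimension inequality $CD(-k,2n,4,2n)$; that is, for every $f\in C^\infty(M)$ and every $\nu>0$, $$\frac{1}{2n}(Lf)^2+\Big(-k-\frac4\nu\Big)\Gamma(f,f)+2n\,\Gamma^Z(f,f)\le\Gamma_2(f,f)+\nu\,\Gamma_2^Z(f,f).$$
   Context: A pseudohermitian $(2n+1)$-manifold $(M,J,\theta)$ is a strictly pseudoconvex CR manifold: a $(2n+1)$-dimensional orientable manifold with contact form $\theta$, contact bundle $\xi=\ker\theta$, and an integrable complex structure $J$ on $\xi$ with positive definite Levi form. $\mathbf{T}$ is the characteristic (Reeb) vector field, and $T_{1,0}M$, $T_{0,1}M$ are the $\pm i$-eigenspaces of $J$ on $\mathbb{C}\otimes\xi$. For a local frame $Z_\alpha$ of $T_{1,0}M$, $Z_{\bar\alpha}=\overline{Z_\alpha}$, with dual coframe $\{\theta,\theta^\alpha,\theta^{\bar\alpha}\}$, one has $d\theta=i h_{\alpha\bar\beta}\theta^\alpha\wedge\theta^{\bar\beta}$ with $(h_{\alpha\bar\beta})$ positive definite Hermitian. The Levi form is $\langle Z,W\rangle=-i\,d\theta(Z,\overline W)=h_{\alpha\bar\beta}Z^\alpha \overline{W^{\beta}}$ on $T_{1,0}M$. Components below are taken in frames with $h_{\alpha\bar\beta}=\delta_{\alpha\beta}$.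 The Tanaka–Webster (pseudohermitian) connection $\nabla$ is given by $\nabla Z_\alpha=\omega_\alpha{}^\beta\otimes Z_\beta$, $\nabla Z_{\bar\alpha}=\omega_{\bar\alpha}{}^{\bar\beta}\otimes Z_{\bar\beta}$, $\nabla \mathbf{T}=0$, where $d\theta^\beta=\theta^\alpha\wedge\omega_\alpha{}^\beta+\theta\wedge\tau^\beta$, $\tau_\alpha\wedge\theta^\alpha=0$, $\omega_\alpha{}^\beta+\omega_{\bar\beta}{}^{\bar\alpha}=0$. The torsion is $A_{\alpha\gamma}=A_{\gamma\alpha}$ with $\tau_\alpha=A_{\alpha\gamma}\theta^\gamma$; vanishing torsion means $A_{\alpha\gamma}=0$. The curvature form has the structure $d\omega_\beta{}^\alpha-\omega_\beta{}^\gamma\wedge\omega_\gamma{}^\alpha=R_\beta{}^\alpha{}_{\rho\bar\sigma}\theta^\rho\wedge\theta^{\bar\sigma}+W_\beta{}^\alpha{}_\rho\theta^\rho\wedge\theta-W^\alpha{}_{\beta\bar\rho}\theta^{\bar\rho}\wedge\theta+i\theta_\beta\wedge\tau^\alpha-i\tau_\beta\wedge\theta^\alpha$. The pseudohermitian Ricci tensor is $R_{\alpha\bar\beta}=R_\gamma{}^\gamma{}_{\alpha\bar\beta}$, and $Ric(Z,Z)=R_{\alpha\bar\beta}Z^\alpha Z^{\bar\beta}$ for $Z=Z^\alpha Z_\alpha$. For a function $u$: $u_\alpha=Z_\alpha u$, $u_{\alpha\bar\beta}=Z_{\bar\beta}Z_\alpha u-\omega_\alpha{}^\gamma(Z_{\bar\beta})Z_\gamma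 u$, $|\nabla_b u|^2=2\sum_\alpha u_\alpha u_{\bar\alpha}$, and $\Delta_b u=\sum_\alpha(u_{\alpha\bar\alpha}+u_{\bar\alpha\alpha})$. Write $Z_j=\frac12(e_j-ie_{n+j})$ with real $e_1,\dots,e_{2n}$. The curvature-dimension inequality is with respect to the operator $L=2\Delta_b$ (written in the paper as $\sum_{j=1}^{2n}e_j^2$), with $d=2n$ horizontal fields $e_j$ and the single extra field $Y_1=\mathbf{T}$. Here $$\Gamma(f,g)=\sum_{j=1}^{2n}(e_jf)(e_jg)\ \ (\text{so }\Gamma(f,f)=2|\nabla_bf|^2),\qquad \Gamma^Z(f,g)=(\mathbf{T}f)(\mathbf{T}g),$$ $$\Gamma_2(f,f)=\tfrac12\big[L(\Gamma(f,f))-2\Gamma(f,Lf)\big],\qquad \Gamma_2^Z(f,f)=\tfrac12\big[L(\Gamma^Z(f,f))-2\Gamma^Z(f,Lf)\big].$$ In general $CD(\rho_1,\rho_2,\kappa,m)$ means $\frac1{m}(Lf)^2+(\rho_1-\frac\kappa\nu)\Gamma(f,f)+\rho_2\Gamma^Z(f,f)\le\Gamma_2(f,f)+\nu\Gamma_2^Z(f,f)$ for all smooth $f$ and all $\nu>0$. *)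

(* Defs.v *)
From mathcomp Require Import all_boot all_order all_algebra.
From mathcomp Require Import complex.
From mathcomp Require Import all_classical all_reals all_analysis.

Set Implicit Arguments.
Unset Strict Implicit.
Unset Printing Implicit Defensive.

Import Order.TTheory GRing.Theory Num.Theory.
Import numFieldNormedType.Exports.

Local Open Scope classical_set_scope.
Local Open Scope ring_scope.

(** * Smooth manifolds *)

Section Euclidean.
Variables (R : realType) (m : nat).

Definition iter_partial (s : seq 'I_m) (g : 'rV[R]_m -> R) : 'rV[R]_m -> R :=
  foldr (fun i h x => 'D_(delta_mx 0 i : 'rV[R]_m) h x) g s.

(* Infinite (Frechet) differentiability; only meant for open O, so that the
   values of g outside O play no role. *)
Definition smooth_on (O : set 'rV[R]_m) (g : 'rV[R]_m -> R) : Prop :=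
  forall (s : seq 'I_m) (x : 'rV[R]_m), O x -> differentiable (iter_partial s g) x.

End Euclidean.

Record chart (R : realType) (m : nat) (M : topologicalType) := Chart {
  dom : set M;
  cod : set 'rV[R]_m;
  chart_map : M -> 'rV[R]_m;
  chart_inv : 'rV[R]_m -> M;
  dom_open : open dom;
  cod_open : open cod;
  chart_map_cod : forall p, dom p -> cod (chart_map p);
  chart_inv_dom : forall y, cod y -> dom (chart_inv y);
  chart_mapK : forall p, dom p -> chart_inv (chart_map p) = p;
  chart_invK : forall y, cod y -> chart_map (chart_inv y) = y;
  chart_map_cont : {within dom, continuous chart_map};
  chart_inv_cont : {within cod, continuous chart_inv} }.

Record manifold (R : realType) (m : nat) := Manifold {
  carrier :> topologicalType;
  atlas : set (chart R m carrier);
  manifold_hausdorff : hausdorff_space carrier;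
  manifold_second_countable : @second_countable carrier;
  atlas_cover : forall p : carrier, exists2 c, atlas c & dom c p;
  atlas_smooth : forall a b : chart R m carrier, atlas a -> atlas b ->
    forall i : 'I_m,
      smooth_on (chart_map a @` (dom a `&` dom b))
                (fun y => chart_map b (chart_inv a y) 0 i) }.

(** * Complexified calculus: vectors, forms, brackets *)

Section Calculus.
Variables (R : realType) (m : nat) (M : manifold R m).
Local Notation C := R[i].

Definition smooth_fun (U : set M) (f : M -> R) : Prop :=
  forall c : chart R m M, atlas c ->
    smooth_on (chart_map c @` (U `&` dom c)) (f \o chart_inv c).

Definition csmooth (U : set M) (f : M -> C) : Prop :=
  smooth_fun U (fun p => complex.Re (f p)) /\
  smooth_fun U (fun p => complex.Im (f p)).

Definition smooth_near (p : M) (f : M -> C) : Prop :=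
  exists2 U : set M, open_nbhs p U & csmooth U f.

Definition cvec := (M -> C) -> C.
Definition cfield := M -> cvec.
Definition cform := M -> cvec -> C.

(* The elements of C (x) T_p M are the C-linear derivations at p of the algebra
   of germs of smooth complex-valued functions.  The last clause only fixes the
   irrelevant values on functions that are not smooth near p, so that equal
   tangent vectors are equal as Rocq functions. *)
Definition tangent (p : M) (D : cvec) : Prop :=
  [/\ forall f g, (\forall q \near p, f q = g q) -> D f = D g,
      forall (a : C) f g, smooth_near p f -> smooth_near p g ->
        D (fun q => a * f q + g q) = a * D f + D g,
      forall f g, smooth_near p f -> smooth_near p g ->
        D (fun q => f q * g q) = D f * g p + f p * D g
    & forall f, ~ smooth_near p f -> D f = 0].

Definition zerov : cvec := fun _ => 0.
Definition addv (D E : cvec) : cvec := fun f => D f + E f.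
Definition scalev (a : C) (D : cvec) : cvec := fun f => a * D f.
(* A tangent vector D is real (lies in T_p M) iff conjv D = D. *)
Definition conjv (D : cvec) : cvec := fun f => ((D (fun q => (f q)^*%C))^*)%C.

Definition vfield (U : set M) (X : cfield) : Prop :=
  (forall p, U p -> tangent p (X p)) /\
  (forall (V : set M) (f : M -> C), open V -> V `<=` U ->
     csmooth V f -> csmooth V (fun q => X q f)).

Definition conjf (X : cfield) : cfield := fun p => conjv (X p).

Definition bracket (X Y : cfield) : cfield := fun p f =>
  if `[< smooth_near p f >]
  then X p (fun q => Y q f) - Y p (fun q => X q f) else 0.

Definition form1 (U : set M) (a : cform) : Prop :=
  (forall p, U p -> forall (z : C) (D E : cvec), tangent p D -> tangent p E ->
     a p (addv (scalev z D) E) = z * a p D + a p E) /\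
  (forall (V : set M) (X : cfield), open V -> V `<=` U -> vfield V X ->
     csmooth V (fun q => a q (X q))).

Definition conj_form (a : cform) : cform := fun p D => ((a p (conjv D))^*)%C.

(* Normalization without the factor 1/2, for both d and the wedge product. *)
Definition dform (a : cform) (X Y : cfield) (p : M) : C :=
  X p (fun q => a q (Y q)) - Y p (fun q => a q (X q)) - a p (bracket X Y p).

Definition wedge (a b : cform) (X Y : cfield) (p : M) : C :=
  a p (X p) * b p (Y p) - a p (Y p) * b p (X p).

Definition eq_form2 (U : set M) (A B : cfield -> cfield -> M -> C) : Prop :=
  forall (V : set M) (X Y : cfield), open V -> V `<=` U ->
    vfield V X -> vfield V Y -> forall p, V p -> A X Y p = B X Y p.

End Calculus.

(** * Pseudohermitian manifolds *)

Section CR.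
Variables (R : realType) (m : nat) (M : manifold R m).
Variables (theta : cform M) (J : M -> cvec M -> cvec M).

Definition horizontal (V : set M) (X : cfield M) : Prop :=
  vfield V X /\ forall p, V p -> theta p (X p) = 0.

Definition contact_form : Prop :=
  [/\ form1 setT theta,
      forall p D, tangent p D -> theta p (conjv D) = ((theta p D)^*)%C,
      forall p, exists2 D : cvec M, tangent p D & theta p D <> 0
    & forall (V : set M) (X : cfield M) (p : M),
        open V -> V p -> horizontal V X -> X p <> @zerov _ _ M ->
        exists (W : set M) (Y : cfield M),
          [/\ open W, W p, horizontal W Y & dform theta X Y p <> 0]].

(* J p is the C-linear extension to C (x) xi_p of a real endomorphism of xi_p;
   its values off C (x) xi_p are irrelevant. *)
Definition complex_structure : Prop :=
  [/\ forall p D, tangent p D -> theta p D = 0 ->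
        [/\ tangent p (J p D), theta p (J p D) = 0,
            J p (J p D) = scalev (-1) D & J p (conjv D) = conjv (J p D)],
      forall p (z : R[i]) D E, tangent p D -> theta p D = 0 ->
        tangent p E -> theta p E = 0 ->
        J p (addv (scalev z D) E) = addv (scalev z (J p D)) (J p E)
    & forall (V : set M) (X : cfield M), open V ->
        horizontal V X -> vfield V (fun p => J p (X p))].

Definition T10_at (p : M) (D : cvec M) : Prop :=
  [/\ tangent p D, theta p D = 0 & J p D = scalev 'i%C D].

Definition T10 (V : set M) (Z : cfield M) : Prop :=
  vfield V Z /\ forall p, V p -> T10_at p (Z p).

Definition integrable_CR : Prop :=
  forall (V : set M) (Z W : cfield M), open V -> T10 V Z -> T10 V W ->
    T10 V (bracket Z W).

Definition levi_form (Z W : cfield M) (p : M) : R[i] :=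
  - 'i%C * dform theta Z (conjf W) p.

(* On R[i], [x <= y] (resp. [x < y]) says that y - x is real and nonnegative
   (resp. positive). *)
Definition strictly_pseudoconvex : Prop :=
  forall (V : set M) (Z : cfield M) (p : M), open V -> T10 V Z -> V p ->
    Z p <> @zerov _ _ M -> 0 < levi_form Z Z p.

End CR.

Record pseudohermitian (R : realType) (n : nat) := Pseudohermitian {
  phM :> manifold R n.*2.+1;
  theta : cform phM;
  cplxJ : phM -> cvec phM -> cvec phM;
  theta_contact : contact_form theta;
  cplxJ_structure : complex_structure theta cplxJ;
  cplxJ_integrable : integrable_CR theta cplxJ;
  levi_pos : strictly_pseudoconvex theta cplxJ }.

Section Webster.
Variables (R : realType) (n : nat) (M : pseudohermitian R n).
Local Notation C := R[i].
Local Notation theta := (@theta R n M).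

Definition levi : cfield M -> cfield M -> M -> C := levi_form theta.

Definition section_T10 (Z : cfield M) : Prop := T10 theta (@cplxJ R n M) setT Z.

Definition reeb (T : cfield M) : Prop :=
  [/\ vfield setT T,
      forall p, conjv (T p) = T p,
      forall p, theta p (T p) = 1
    & forall (V : set M) (X : cfield M), open V -> vfield V X ->
        forall p, V p -> dform theta T X p = 0].

Definition frame_T10 (U : set M) (Z : 'I_n -> cfield M) : Prop :=
  (forall a, T10 theta (@cplxJ R n M) U (Z a)) /\
  (forall p D, U p -> T10_at theta (@cplxJ R n M) p D ->
     exists! c : 'I_n -> C, D = (fun f => \sum_a c a * Z a p f)).

Definition orthonormal (U : set M) (Z : 'I_n -> cfield M) : Prop :=
  forall a b p, U p -> levi (Z a) (Z b) p = (a == b)%:R.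

Definition dual_coframe (T : cfield M) (U : set M) (Z : 'I_n -> cfield M)
    (th : 'I_n -> cform M) : Prop :=
  [/\ forall a, form1 U (th a),
      forall a b p, U p -> th a p (Z b p) = (a == b)%:R,
      forall a b p, U p -> th a p (conjf (Z b) p) = 0
    & forall a p, U p -> th a p (T p) = 0].

(* tau_low th A a is tau_a = A_{ac} th^c; as h_{ab} = delta_{ab}, raising the
   index gives tau^a = conj (tau_a). *)
Definition tau_low (th : 'I_n -> cform M) (A : 'I_n -> 'I_n -> M -> C)
    (a : 'I_n) : cform M :=
  fun p D => \sum_c A a c p * th c p D.

(* An orthonormal frame Z_a of T_{1,0} on an open set U, its dual coframe th^a,
   the connection forms [om a b] = omega_a^b of the Tanaka-Webster connection,
   and the components A_{ac} of its torsion; om and A are determined by Z. *)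
Record webster_frame (T : cfield M) (U : set M) := WebsterFrame {
  wZ : 'I_n -> cfield M;
  wth : 'I_n -> cform M;
  wom : 'I_n -> 'I_n -> cform M;
  wA : 'I_n -> 'I_n -> M -> C;
  wZ_frame : frame_T10 U wZ;
  wZ_orthonormal : orthonormal U wZ;
  wth_dual : dual_coframe T U wZ wth;
  wom_form : forall a b, form1 U (wom a b);
  wA_smooth : forall a c, csmooth U (wA a c);
  structure_eq : forall b, eq_form2 U (dform (wth b)) (fun X Y p =>
    \sum_a wedge (wth a) (wom a b) X Y p
    + wedge theta (conj_form (tau_low wth wA b)) X Y p);
  torsion_eq : eq_form2 U
    (fun X Y p => \sum_a wedge (tau_low wth wA a) (wth a) X Y p)
    (fun _ _ _ => 0);
  skew_eq : forall a b p D, U p -> tangent p D ->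
    wom a b p D + conj_form (wom b a) p D = 0 }.

Definition vanishing_torsion (T : cfield M) : Prop :=
  forall (U : set M), open U -> forall F : webster_frame T U,
    forall a c p, U p -> wA F a c p = 0.

Section Frame.
Variables (T : cfield M) (U : set M) (F : webster_frame T U).
Local Notation Z := (wZ F).
Local Notation om := (wom F).

Definition curvature_form (b a : 'I_n) (X Y : cfield M) (p : M) : C :=
  dform (om b a) X Y p - \sum_c wedge (om b c) (om c a) X Y p.

(* R_b^a_{r \bar s} is the coefficient of th^r /\ conj(th^s) in the curvature
   form.  The other terms of the structure equation (those in W and in the
   torsion) are of type (1,0) /\ theta, (0,1) /\ theta, (0,2) or (2,0), so the
   coefficient is the value on (Z_r, conj Z_s). *)
Definition curvature (b a r s : 'I_n) (p : M) : C :=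
  curvature_form b a (Z r) (conjf (Z s)) p.

Definition ricci_tensor (a b : 'I_n) (p : M) : C := \sum_c curvature c c a b p.

Definition Ric (W : cfield M) (p : M) : C :=
  \sum_a \sum_b ricci_tensor a b p * wth F a p (W p) * ((wth F b p (W p))^*)%C.

(* u_{a \bar b} and u_{\bar a b} *)
Definition hess_ab' (a b : 'I_n) (u : M -> C) (p : M) : C :=
  conjf (Z b) p (fun q => Z a q u)
  - \sum_c om a c p (conjf (Z b) p) * Z c p u.
Definition hess_a'b (a b : 'I_n) (u : M -> C) (p : M) : C :=
  Z b p (fun q => conjf (Z a) q u)
  - \sum_c conj_form (om a c) p (Z b p) * conjf (Z c) p u.

Definition sublaplacian (u : M -> C) (p : M) : C :=
  \sum_a (hess_ab' a a u p + hess_a'b a a u p).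

Definition opL (u : M -> C) (p : M) : C := 2 * sublaplacian u p.

(* The real fields with Z_j = (e_j - i e_{n+j}) / 2. *)
Definition real_frame (j : 'I_(n + n)) : cfield M :=
  match fintype.split j with
  | inl a => fun p => addv (Z a p) (conjf (Z a) p)
  | inr a => fun p => scalev 'i%C (addv (Z a p) (scalev (-1) (conjf (Z a) p)))
  end.

Definition Gamma (f g : M -> C) (p : M) : C := \sum_j real_frame j p f * real_frame j p g.

Definition GammaZ (f g : M -> C) (p : M) : C := T p f * T p g.

Definition Gamma2 (f : M -> C) (p : M) : C :=
  2^-1 * (opL (Gamma f f) p - 2 * Gamma f (opL f) p).

Definition GammaZ2 (f : M -> C) (p : M) : C :=
  2^-1 * (opL (GammaZ f f) p - 2 * GammaZ f (opL f) p).

End Frame.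

(* opL, Gamma and Ric are globally defined; at a point they are computed
   in an arbitrary orthonormal frame around it. *)
Definition ricci_lower_bound (T : cfield M) (k : R) : Prop :=
  forall W : cfield M, section_T10 W ->
  forall U : set M, open U -> forall F : webster_frame T U,
  forall p, U p -> - k%:C%C * levi W W p <= 2 * Ric F W p.

Definition CD (T : cfield M) (rho1 rho2 kappa m : R) : Prop :=
  forall f : M -> R, smooth_fun setT f -> forall nu : R, 0 < nu ->
  forall U : set M, open U -> forall F : webster_frame T U,
  forall p, U p ->
  let fC : M -> C := fun q => (f q)%:C%C in
  (m^-1)%:C%C * opL F fC p ^+ 2 + (rho1 - kappa / nu)%:C%C * Gamma F fC fC p
    + rho2%:C%C * GammaZ T fC fC p
  <= Gamma2 F fC p + nu%:C%C * GammaZ2 F fC p.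

End Webster.

(* Main.v *)
(* Write u_a = Z_a f, f_0 = T f, and let f_{ab}, f_{a bbar} be the second
   covariant derivatives. As the torsion vanishes, T commutes with L, so that
   Gamma_2^Z(f,f) = Gamma(f_0,f_0), and the Bochner identity reads
     Gamma_2(f,f) = 8 sum (|f_{ab}|^2 + |f_{a bbar}|^2) + 8 Ric(W,W)
                    + 8i sum (conj(u_a) Z_a f_0 - u_a conj(Z_a f_0)),
   where W = sum conj(u_a) Z_a. The imaginary part of f_{a abar} is f_0/2, so
   Cauchy-Schwarz on the diagonal of f_{a bbar} yields (Lf)^2/(2n) + 2n f_0^2,
   and the last sum is absorbed by (4/nu) Gamma(f,f) + nu Gamma(f_0,f_0).
   The Bochner identity is derived algebraically, for derivations of a
   commutative ring satisfying the commutation relations of the frame; the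
   Bianchi identities needed to identify the Ricci term follow from these
   relations and the linear independence of the frame. *)

Require Import Defs.
From HB Require Import structures.
From mathcomp Require Import all_boot all_order all_algebra ring lra.
From mathcomp Require Import complex.
From mathcomp Require Import all_classical all_reals all_analysis.
Import Defs.

Set Implicit Arguments.
Unset Strict Implicit.
Unset Printing Implicit Defensive.

Import Order.TTheory GRing.Theory Num.Theory.
Import numFieldNormedType.Exports.
Local Open Scope classical_set_scope.
Local Open Scope ring_scope.

(** * Derivations and connections *)

Section Derivations.
Variable A : comPzRingType.
Implicit Types (X Y : A -> A) (x y : A).

(** A tangent vector acts on germs at one point, while identities between iterated derivatives hold
    on the open set U carrying the frame. Smooth functions on U, extended by zero, form a
    commutative ring on which the frame fields are derivations; there the tensor calculus is pure
    [ring] computation, free of topology. The abstract ring carries no complex conjugation. Instead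
    each frame has a conjugate frame, another instance of the same structure, so that a statement
    proved for every frame also yields its conjugate. The reality of f enters only at the end, where
    bilinear pairings become norms. Besides the Ricci term, two curvature components must be
    controlled: the (2,0) one, in order to commute (0,1)-derivatives, and the one along T, in order
    to commute T with the sublaplacian. The link with geometry needs bump functions twice: a tangent
    vector at p must be determined by functions smooth on all of U, and the Ricci bound is given for
    global sections whereas the frame is local. *)

Definition derivation X :=
  (forall x y, X (x + y) = X x + X y) /\ (forall x y, X (x * y) = X x * y + x * X y).

Lemma derD X x y : derivation X -> X (x + y) = X x + X y.
Proof. by case. Qed.

Lemma derM X x y : derivation X -> X (x * y) = X x * y + x * X y.
Proof. by case. Qed.

Lemma der0 X : derivation X -> X 0 = 0.
Proof. by move=> dX; apply: (addrI (X 0)); rewrite -(derD _ _ dX) !addr0. Qed.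

Lemma der1 X : derivation X -> X 1 = 0.
Proof. by move=> dX; apply: (addrI (X 1)); have := derM 1 1 dX; rewrite !mulr1 mul1r addr0 => <-. Qed.

Lemma derN X x : derivation X -> X (- x) = - X x.
Proof. by move=> dX; apply/eqP; rewrite -addr_eq0 -(derD _ _ dX) addNr (der0 dX). Qed.

Lemma derB X x y : derivation X -> X (x - y) = X x - X y.
Proof. by move=> dX; rewrite (derD _ _ dX) (derN _ dX). Qed.

Lemma der_sum X (I : finType) (F : I -> A) : derivation X -> X (\sum_i F i) = \sum_i X (F i).
Proof. by move=> dX; apply: (big_morph X (fun x y => derD x y dX) (der0 dX)). Qed.

Lemma der_nat X k : derivation X -> X k%:R = 0.
Proof.
by move=> dX; elim: k => [|k IH]; rewrite ?(der0 dX) // -natr1 (derD _ _ dX) IH (der1 dX) addr0.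
Qed.

Section Connection.
Variable n : nat.
Implicit Types (u v : 'I_n -> A) (L : 'I_n -> 'I_n -> A).

(** The entry [L a c] stands for omega_a^c(X), already evaluated on X. The matrix is a separate
    argument so that (1,0)- and (0,1)-forms share one definition. *)
Definition cov X L u a := X (u a) - \sum_c L a c * u c.

Lemma eq_cov X L u v a : u =1 v -> cov X L u a = cov X L v a.
Proof. by move=> uv; rewrite /cov uv; congr (_ - _); apply: eq_bigr => c _; rewrite uv. Qed.

(** The terms with one derivative of u are symmetric in X and Y and cancel. What remains beside the
    commutator on [u a] is d omega - omega /\ omega without the value of omega on the bracket; that
    value appears once the commutator is expanded by the frame relations. *)
Lemma cov_comm X Y L1 L2 u a : derivation X -> derivation Y ->
  cov X L1 (cov Y L2 u) a - cov Y L2 (cov X L1 u) a =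
  X (Y (u a)) - Y (X (u a))
  - \sum_c (X (L2 a c) - Y (L1 a c)
            - \sum_d (L1 a d * L2 d c - L2 a d * L1 d c)) * u c.
Proof.
move=> dX dY; rewrite /cov (derB _ _ dX) (derB _ _ dY) (der_sum _ dX) (der_sum _ dY).
have HX W L : derivation W -> \sum_c W (L a c * u c) =
    \sum_c W (L a c) * u c + \sum_c L a c * W (u c).
  by move=> dW; rewrite -big_split; apply: eq_bigr => c _; rewrite (derM _ _ dW).
have H W L L' : \sum_c L a c * (W (u c) - \sum_d L' c d * u d) =
    \sum_c L a c * W (u c) - \sum_c (\sum_d L a d * L' d c) * u c.
  under eq_bigr do rewrite mulrBr big_distrr.
  rewrite sumrB exchange_big; congr (_ - _); apply: eq_bigr => c _.
  by rewrite big_distrl; apply: eq_bigr => d _ /=; rewrite mulrA.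
rewrite (HX X L2) // (HX Y L1) // !H.
under [in RHS]eq_bigr do rewrite sumrB !mulrBl.
rewrite !sumrB /=.
ring.
Qed.

(** Minus the transpose of L is the dual connection, so the connection terms cancel in the pairing.
    In a unitary frame this dual connection is the conjugate one, acting on (0,1)-forms. *)
Lemma cov_fpair X L u v : derivation X ->
  X (\sum_a u a * v a) =
  \sum_a (cov X L u a * v a + u a * cov X (fun a c => - L c a) v a).
Proof.
move=> dX; rewrite der_sum // /cov.
under eq_bigr do rewrite (derM _ _ dX).
under [in RHS]eq_bigr do rewrite mulrBl mulrBr.
rewrite !big_split /= !sumrN.
have -> : \sum_a u a * (\sum_c - L c a * v c) = - \sum_a (\sum_c L a c * u c) * v a.
  under eq_bigr do rewrite big_distrr.
  rewrite exchange_big -sumrN; apply: eq_bigr => a _ /=.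
  rewrite big_distrl -sumrN; apply: eq_bigr => c _ /=; ring.
ring.
Qed.

End Connection.

Lemma sum_delta n (F : 'I_n -> A) s : \sum_c F c * (c == s)%:R = F s.
Proof.
rewrite (bigD1 s) //= eqxx mulr1 big1 ?addr0 // => c /negbTE ->; exact: mulr0.
Qed.

End Derivations.

(* The commutation relations of an orthonormal frame with vanishing torsion:
   P, Q and N stand for the components omega_a^b(Z_c), omega_a^b(conj Z_c) and
   omega_a^b(T) of the connection, and the last field expresses the linear
   independence of the frame. *)
Record frame_algebra (A : comPzRingType) (n : nat) := FrameAlgebra {
  fZ : 'I_n -> A -> A;
  fZb : 'I_n -> A -> A;
  fT : A -> A;
  fP : 'I_n -> 'I_n -> 'I_n -> A;
  fQ : 'I_n -> 'I_n -> 'I_n -> A;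
  fN : 'I_n -> 'I_n -> A;
  fi : A;
  der_fZ : forall a, derivation (fZ a);
  der_fZb : forall a, derivation (fZb a);
  der_fT : derivation fT;
  fZ_i : forall a, fZ a fi = 0;
  fZb_i : forall a, fZb a fi = 0;
  fT_i : fT fi = 0;
  brZZb : forall a c f, fZ a (fZb c f) - fZb c (fZ a f) =
    - \sum_b fQ a b c * fZ b f - \sum_b fP b c a * fZb b f
    - fi * (a == c)%:R * fT f;
  brZZ : forall a c f, fZ a (fZ c f) - fZ c (fZ a f) =
    \sum_b (fP c b a - fP a b c) * fZ b f;
  brZbZb : forall a c f, fZb a (fZb c f) - fZb c (fZb a f) =
    \sum_b (fQ b a c - fQ b c a) * fZb b f;
  brTZ : forall a f, fT (fZ a f) - fZ a (fT f) = \sum_b fN a b * fZ b f;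
  brTZb : forall a f, fT (fZb a f) - fZb a (fT f) = - \sum_b fN b a * fZb b f;
  findep : forall x y : 'I_n -> A,
    (forall f, \sum_c x c * fZ c f + \sum_c y c * fZb c f = 0) ->
    (forall c, x c = 0) /\ (forall c, y c = 0) }.

(** * Symmetry under complex conjugation *)

Section Conjugate.
Variables (A : comPzRingType) (n : nat) (F : frame_algebra A n).

Fact fconj_i X : derivation X -> X (fi F) = 0 -> X (- fi F) = 0.
Proof. by move=> dX Xi; rewrite (derN _ dX) Xi oppr0. Qed.

Fact fconj_ZZb a c f : fZb F a (fZ F c f) - fZ F c (fZb F a f) =
  - \sum_b - fP F b a c * fZb F b f - \sum_b - fQ F c b a * fZ F b f
  - - fi F * (a == c)%:R * fT F f.
Proof.
rewrite -opprB brZZb eq_sym.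
under [X in _ = - X - _ - _]eq_bigr do rewrite mulNr.
under [X in _ = _ - X - _]eq_bigr do rewrite mulNr.
by rewrite !sumrN; ring.
Qed.

Fact fconj_ZZ a c f : fZb F a (fZb F c f) - fZb F c (fZb F a f) =
  \sum_b (- fQ F b c a - - fQ F b a c) * fZb F b f.
Proof. by rewrite brZbZb; apply: eq_bigr => b _; ring. Qed.

Fact fconj_ZbZb a c f : fZ F a (fZ F c f) - fZ F c (fZ F a f) =
  \sum_b (- fP F a b c - - fP F c b a) * fZ F b f.
Proof. by rewrite brZZ; apply: eq_bigr => b _; ring. Qed.

Fact fconj_TZ a f : fT F (fZb F a f) - fZb F a (fT F f) = \sum_b - fN F b a * fZb F b f.
Proof. by rewrite brTZb -sumrN; apply: eq_bigr => b _; ring. Qed.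

Fact fconj_TZb a f : fT F (fZ F a f) - fZ F a (fT F f) = - \sum_b - fN F a b * fZ F b f.
Proof. by rewrite brTZ -sumrN; apply: eq_bigr => b _; ring. Qed.

Fact fconj_indep (x y : 'I_n -> A) :
  (forall f, \sum_c x c * fZb F c f + \sum_c y c * fZ F c f = 0) ->
  (forall c, x c = 0) /\ (forall c, y c = 0).
Proof.
move=> H; have [|y0 x0] := @findep _ _ F y x; last by split.
by move=> f; rewrite addrC.
Qed.

(* The conjugate frame: exchanging Z and conj Z turns omega_a^b into its
   conjugate - omega_b^a, and i into - i. *)
Definition fconj : frame_algebra A n :=
  @FrameAlgebra A n (fZb F) (fZ F) (fT F)
    (fun a c r => - fQ F c a r) (fun a c r => - fP F c a r) (fun a c => - fN F c a) (- fi F)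
    (der_fZb F) (der_fZ F) (der_fT F) (fun a => fconj_i (der_fZb F a) (fZb_i F a))
    (fun a => fconj_i (der_fZ F a) (fZ_i F a)) (fconj_i (der_fT F) (fT_i F))
    fconj_ZZb fconj_ZZ fconj_ZbZb fconj_TZ fconj_TZb fconj_indep.

End Conjugate.

(** * The Bochner identity *)

Section Bochner.
Variables (A : comPzRingType) (n : nat).
Implicit Types (F : frame_algebra A n) (u v : 'I_n -> A) (f : A).

Definition nZ F r := cov (fZ F r) (fun a c => fP F a c r).
Definition nZb F s := cov (fZb F s) (fun a c => fQ F a c s).
Definition nT F := cov (fT F) (fN F).
(* nZ, nZb and nT act on the components of (1,0)-forms, nZ01, nZb01 and nT01 on those of
   (0,1)-forms, whose connection matrix is the conjugate one. *)
Definition nZ01 F := nZb (fconj F).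
Definition nZb01 F := nZ (fconj F).
Definition nT01 F := nT (fconj F).
Definition grad10 F f a := fZ F a f.
Definition grad01 F f a := fZb F a f.

(** The value of omega_b^a on the bracket of Z_r and conj Z_s, read off from [brZZb]; it is the
    bracket term of d omega in [curv]. *)
Definition om_br F b a r s := - \sum_d fQ F r d s * fP F b a d
  - \sum_d fP F d s r * fQ F b a d - fi F * (r == s)%:R * fN F b a.

Definition curv F b a r s := fZ F r (fQ F b a s) - fZb F s (fP F b a r)
  - om_br F b a r s - \sum_c (fP F b c r * fQ F c a s - fQ F b c s * fP F c a r).

(* The components of type (2,0) and along T of the curvature, both of which the
   Bianchi identity shows to vanish. *)
Definition curv20 F b a r s := fZ F r (fP F b a s) - fZ F s (fP F b a r)
  - \sum_d (fP F s d r - fP F r d s) * fP F b a d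
  - \sum_c (fP F b c r * fP F c a s - fP F b c s * fP F c a r).

Definition curvT F b a s := fT F (fQ F b a s) - fZb F s (fN F b a)
  + \sum_d fN F d s * fQ F b a d
  - \sum_c (fN F b c * fQ F c a s - fQ F b c s * fN F c a).

Lemma sum_cov (I : finType) (k : I -> A) (X : I -> A -> A) (L : I -> 'I_n -> 'I_n -> A) u a :
  \sum_d k d * cov (X d) (L d) u a =
  \sum_d k d * X d (u a) - \sum_c (\sum_d k d * L d a c) * u c.
Proof.
under eq_bigr do rewrite mulrBr big_distrr.
rewrite sumrB exchange_big; congr (_ - _); apply: eq_bigr => c _.
by rewrite big_distrl; apply: eq_bigr => d _ /=; rewrite mulrA.
Qed.

(** Reduces an equation to a [ring] identity exhibiting it as the difference of two known
    equations. *)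
Lemma eq_comb (x1 y1 x2 y2 x y : A) :
  x1 = y1 -> x2 = y2 -> x - y = (x1 - y1) - (x2 - y2) -> x = y.
Proof. by move=> -> -> /eqP; rewrite !subrr subr_eq0 => /eqP. Qed.

Lemma sum_mulBl (x y z : 'I_n -> A) :
  \sum_c (x c - y c) * z c = \sum_c x c * z c - \sum_c y c * z c.
Proof. by rewrite -sumrB; apply: eq_bigr => c _; rewrite mulrBl. Qed.

Lemma sum_mulNl (x z : 'I_n -> A) : \sum_c (- x c) * z c = - \sum_c x c * z c.
Proof. by rewrite -sumrN; apply: eq_bigr => c _; rewrite mulNr. Qed.

Lemma nZ01E F r v a : nZ01 F r v a = fZ F r (v a) + \sum_c fP F c a r * v c.
Proof. by rewrite /nZ01 /nZb /cov /= sum_mulNl opprK. Qed.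

(** The Ricci identity. Expanding the bracket gives plain derivatives of u; completing them to
    covariant ones costs exactly the terms of [om_br], which complete the curvature. *)
Lemma comm_nZ_nZb F r s u a : nZ F r (nZb F s u) a - nZb F s (nZ F r u) a =
  - \sum_d fQ F r d s * nZ F d u a - \sum_d fP F d s r * nZb F d u a
  - fi F * (r == s)%:R * nT F u a - \sum_c curv F a c r s * u c.
Proof.
rewrite (cov_comm _ _ _ _ (der_fZ F r) (der_fZb F s)).
rewrite brZZb !sum_cov /nT /cov mulrBr big_distrr /=.
have -> : \sum_c curv F a c r s * u c =
   \sum_c (fZ F r (fQ F a c s) - fZb F s (fP F a c r)
           - \sum_d (fP F a d r * fQ F d c s - fQ F a d s * fP F d c r)) * u c
   + \sum_c (\sum_d fQ F r d s * fP F a c d) * u c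
   + \sum_c (\sum_d fP F d s r * fQ F a c d) * u c
   + \sum_c fi F * (r == s)%:R * (fN F a c * u c).
  by rewrite -!big_split; apply: eq_bigr => c _ /=; rewrite /curv /om_br; ring.
ring.
Qed.

Lemma comm_nT_nZb F s u a : nT F (nZb F s u) a - nZb F s (nT F u) a =
  - \sum_d fN F d s * nZb F d u a - \sum_c curvT F a c s * u c.
Proof.
rewrite (cov_comm _ _ _ _ (der_fT F) (der_fZb F s)).
rewrite brTZb sum_cov.
have -> : \sum_c curvT F a c s * u c =
   \sum_c (fT F (fQ F a c s) - fZb F s (fN F a c)
           - \sum_d (fN F a d * fQ F d c s - fQ F a d s * fN F d c)) * u c
   + \sum_c (\sum_d fN F d s * fQ F a c d) * u c.
  by rewrite -big_split; apply: eq_bigr => c _ /=; rewrite /curvT; ring.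
ring.
Qed.

(** On (0,1)-forms the connection matrix is minus the transpose, so the curvature enters with the
    opposite sign and with its two matrix indices exchanged. *)
Lemma comm_nZ01_nZ01 F r s v a : nZ01 F r (nZ01 F s v) a - nZ01 F s (nZ01 F r v) a =
  \sum_d (fP F s d r - fP F r d s) * nZ01 F d v a - \sum_c (- curv20 F c a r s) * v c.
Proof.
rewrite (cov_comm _ _ _ _ (der_fZ F r) (der_fZ F s)) /=.
rewrite brZZ sum_cov /=.
have -> : \sum_c (- curv20 F c a r s) * v c =
   \sum_c (fZ F r (- fP F c a s) - fZ F s (- fP F c a r)
           - \sum_d ((- fP F d a r) * (- fP F c d s) - (- fP F d a s) * (- fP F c d r))) * v c
   - \sum_c (\sum_d (fP F s d r - fP F r d s) * (- fP F c a d)) * v c.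
  rewrite -sumrB; apply: eq_bigr => c _ /=; rewrite /curv20 (derN _ (der_fZ F r)) (derN _ (der_fZ F s)).
  under [X in _ = (_ - X) * _ - _]eq_bigr => d _.
    rewrite (_ : _ - _ = - (fP F c d r * fP F d a s - fP F c d s * fP F d a r)); last by ring.
  over.
  under [X in _ = _ - X * _]eq_bigr => d _ do rewrite mulrN.
  by rewrite !sumrN; ring.
ring.
Qed.

Lemma comm_nT01_nZ01 F r v a : nT01 F (nZ01 F r v) a - nZ01 F r (nT01 F v) a =
  \sum_d fN F r d * nZ01 F d v a - \sum_c curvT (fconj F) a c r * v c.
Proof.
rewrite /nZ01 /nT01 comm_nT_nZb /=; congr (_ - _).
by rewrite -sumrN; apply: eq_bigr => d _; ring.
Qed.

(** The bracket of two (1,0)-fields has no T-component, and its coefficients are the antisymmetrized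
    connection coefficients, which the covariant derivative subtracts. *)
Lemma hess_sym F f a b : nZ F b (grad10 F f) a = nZ F a (grad10 F f) b.
Proof.
have := brZZ F a b f; rewrite /nZ /cov /grad10.
under eq_bigr do rewrite mulrBl.
by rewrite sumrB => /eqP; rewrite subr_eq => /eqP ->; ring.
Qed.

(** The connection terms match the (1,0)- and (0,1)-parts of the bracket; only its T-component
    survives. On the diagonal this fixes the imaginary part of f_{a abar} for real f. *)
Lemma hess_mixed F f a s :
  nZb F s (grad10 F f) a = nZ01 F a (grad01 F f) s + fi F * (a == s)%:R * fT F f.
Proof.
have := brZZb F a s f; rewrite /nZ01 /nZb /cov /grad10 /grad01 /= => /eqP.
rewrite subr_eq => /eqP ->.
under [X in _ = _ - X + _]eq_bigr do rewrite mulNr.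
by rewrite sumrN; ring.
Qed.

(** Vanishing torsion at work: the bracket of T and Z_a has no conj Z component. *)
Lemma nT_grad F f a : nT F (grad10 F f) a = fZ F a (fT F f).
Proof.
by have := brTZ F a f; rewrite /nT /cov /grad10 => /eqP; rewrite subr_eq => /eqP ->; ring.
Qed.

(** Only a is differentiated as a form index, s being held fixed. The term in [fP F a s b] left by
    the Kronecker delta is cancelled in [thirdE], where s is treated covariantly too. *)
Lemma nZ_nZb_grad F f a b s :
  nZ F b (nZb F s (grad10 F f)) a = fZ F b (nZ01 F a (grad01 F f) s)
    + fi F * (a == s)%:R * fZ F b (fT F f)
    - \sum_c fP F a c b * nZ01 F c (grad01 F f) s - fP F a s b * (fi F * fT F f).
Proof.
rewrite {1}/nZ /cov hess_mixed.
under eq_bigr do rewrite hess_mixed mulrDr.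
rewrite (derD _ _ (der_fZ F b)) !(derM _ _ (der_fZ F b)) fZ_i (der_nat _ (der_fZ F b)) big_split /=.
rewrite -(sum_delta (fun c => fP F a c b * (fi F * fT F f)) s).
rewrite (_ : \sum_c _ * _ * _ = \sum_i fP F a i b * (fi F * (i == s)%:R * fT F f)).
  by ring.
by apply: eq_bigr => c _; ring.
Qed.

(* The third covariant derivative f_{a b sbar}. *)
Definition third F f a b s := nZb F s (nZ F b (grad10 F f)) a
  - \sum_c fQ F b c s * nZ F c (grad10 F f) a.

Lemma third_sym F f a b s : third F f a b s = third F f b a s.
Proof.
rewrite /third /nZb /cov hess_sym.
under eq_bigr do rewrite hess_sym.
under [X in _ - X]eq_bigr do rewrite hess_sym.
by ring.
Qed.

(** The Ricci identity moves the barred index innermost, giving f_{sbar a b}. The T-terms are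
    symmetric in a and b, so exchanging a and b isolates the curvature. *)
Lemma thirdE F f a b s : third F f a b s =
  nZ01 F b (nZ01 F a (grad01 F f)) s - \sum_c fP F a c b * nZ01 F c (grad01 F f) s
  + fi F * ((a == s)%:R * fZ F b (fT F f) + (b == s)%:R * fZ F a (fT F f))
  + \sum_c curv F a c b s * grad10 F f c.
Proof.
rewrite /third -[nZb F s _ a](subKr (nZ F b (nZb F s (grad10 F f)) a)) comm_nZ_nZb nT_grad.
rewrite nZ_nZb_grad.
have -> : \sum_d fP F d s b * nZb F d (grad10 F f) a = \sum_d fP F d s b * nZ01 F a (grad01 F f) d
    + fP F a s b * (fi F * fT F f).
  under eq_bigr do rewrite hess_mixed mulrDr.
  rewrite big_split /=; congr (_ + _).
  rewrite -(sum_delta (fun c => fP F c s b * (fi F * fT F f)) a).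
  by apply: eq_bigr => c _; rewrite eq_sym; ring.
have -> : nZ01 F b (nZ01 F a (grad01 F f)) s = fZ F b (nZ01 F a (grad01 F f) s)
    + \sum_d fP F d s b * nZ01 F a (grad01 F f) d.
  rewrite {1}/nZ01 /nZb /cov /= -sumrN; congr (_ + _); apply: eq_bigr => c _; ring.
ring.
Qed.

(* f_{ab} is symmetric, so antisymmetrizing f_{a b sbar} in a and b leaves a
   combination of the Z_c f and conj Z_c f with curvature coefficients, which
   vanishes for all f. *)
Lemma bianchi F : (forall a b c s, curv F a c b s = curv F b c a s) /\
  (forall a b s c, curv20 F c s b a = 0).
Proof.
suff H a b s : (forall c, curv F a c b s - curv F b c a s = 0) /\
    (forall c, curv20 F c s b a = 0).
  by split=> [a b c s|a b s c]; [apply/eqP; rewrite -subr_eq0 (H a b s).1|exact: (H a b s).2].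
(* Both identities are read off at once: the coefficients of Z_c f give the first one, those of conj
   Z_c f the second. *)
apply: findep (F) _ _ _ => f.
have := third_sym F f a b s; rewrite !thirdE => /eqP; rewrite -subr_eq0 => /eqP Hf.
(* Antisymmetrizing f_{sbar a b} produces a commutator of (0,1)-derivatives, hence [curv20] paired
   with the conj Z_c f. *)
have He := comm_nZ01_nZ01 F b a (grad01 F f) s.
rewrite (sum_mulBl (fun c => curv F a c b s) (fun c => curv F b c a s)) -[RHS]Hf.
have -> : \sum_c curv20 F c s b a * fZb F c f = nZ01 F b (nZ01 F a (grad01 F f)) s - nZ01 F a (nZ01 F b (grad01 F f)) s
   - \sum_d (fP F a d b - fP F b d a) * nZ01 F d (grad01 F f) s.
  by rewrite He sum_mulNl /grad01; ring.
rewrite sum_mulBl /grad10; ring.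
Qed.

(** The second derivatives f_{a sbar} and f_{sbar a} differ by a multiple of f_0, so the Ricci
    identities for T along the two must agree. Their difference has only curvature terms: a
    combination of the Z_c f and conj Z_c f that vanishes for all f, to which independence
    applies. *)
Lemma curvT0 F a k s : curvT F a k s = 0.
Proof.
suff [] : (forall c, curvT F a c s = 0) /\ (forall c, - curvT (fconj F) s c a = 0) by [].
apply: findep (F) _ _ _ => f.
have H1 : nT F (nZb F s (grad10 F f)) a = fT F (nZ01 F a (grad01 F f) s)
    + fi F * (a == s)%:R * fT F (fT F f)
    - \sum_c fN F a c * nZ01 F c (grad01 F f) s - fN F a s * (fi F * fT F f).
  rewrite {1}/nT /cov hess_mixed.
  under eq_bigr do rewrite hess_mixed mulrDr.
  rewrite (derD _ _ (der_fT F)) !(derM _ _ (der_fT F)) fT_i (der_nat _ (der_fT F)) big_split /=.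
  rewrite -(sum_delta (fun c => fN F a c * (fi F * fT F f)) s).
  rewrite (_ : \sum_c fN F a c * (_ * _) = \sum_i fN F a i * (fi F * fT F f) * (i == s)%:R).
    by ring.
  by apply: eq_bigr => c _; ring.
have H2 : \sum_d fN F d s * nZb F d (grad10 F f) a = \sum_d fN F d s * nZ01 F a (grad01 F f) d
    + fN F a s * (fi F * fT F f).
  under eq_bigr do rewrite hess_mixed mulrDr.
  rewrite big_split /=; congr (_ + _).
  rewrite -(sum_delta (fun c => fN F c s * (fi F * fT F f)) a).
  by apply: eq_bigr => c _; rewrite eq_sym; ring.
have H3 : nT01 F (nZ01 F a (grad01 F f)) s = fT F (nZ01 F a (grad01 F f) s)
    + \sum_d fN F d s * nZ01 F a (grad01 F f) d.
  by rewrite {1}/nT01 /nT /cov /= -sumrN; congr (_ + _); apply: eq_bigr => c _; ring.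
have H4 : nZb F s (nT F (grad10 F f)) a = nZ01 F a (nT01 F (grad01 F f)) s
    + fi F * (a == s)%:R * fT F (fT F f).
  have -> : nZ01 F a (nT01 F (grad01 F f)) s = nZ01 F a (grad01 F (fT F f)) s.
    exact: (eq_cov _ _ _ (nT_grad (fconj F) f)).
  by rewrite -hess_mixed; exact: (eq_cov _ _ _ (nT_grad F f)).
have := comm_nT_nZb F s (grad10 F f) a; have := comm_nT01_nZ01 F a (grad01 F f) s.
rewrite H1 H2 H3 H4 => e1 e2.
rewrite sum_mulNl.
set x := nZ01 F a _ s in e1 e2.
change (\sum_c curvT F a c s * grad10 F f c - \sum_c curvT (fconj F) s c a * grad01 F f c = 0).
by apply: (eq_comb e2 e1); ring.
Qed.

(** * Laplacians on functions and on (1,0)-forms *)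

Definition fpair u v := \sum_a u a * v a.

(* Delta_b, that is, half the operator L. *)
Definition sublap F x :=
  \sum_b (nZb F b (grad10 F x) b + nZ01 F b (grad01 F x) b).

(* The analogue of sublap on (1,0)-forms. *)
Definition rough_lap F u a := \sum_b (nZb F b (nZ F b u) a + nZ F b (nZb F b u) a)
  - \sum_c (\sum_b fQ F b c b) * nZ F c u a + \sum_c (\sum_b fP F c b b) * nZb F c u a.

Definition ric F a c := \sum_b curv F b b a c.

Lemma sum_exch (x : 'I_n -> 'I_n -> A) (y : 'I_n -> A) :
  \sum_b \sum_c x b c * y c = \sum_c (\sum_b x b c) * y c.
Proof. by rewrite exchange_big; apply: eq_bigr => c _; rewrite big_distrl. Qed.

(** The first-order coefficients are those of [rough_lap], so both operators have the same shape and
    a Leibniz rule can relate them. *)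
Lemma sublapE F x : sublap F x = \sum_b (fZb F b (fZ F b x) + fZ F b (fZb F b x))
  - \sum_c (\sum_b fQ F b c b) * fZ F c x + \sum_c (\sum_b fP F c b b) * fZb F c x.
Proof.
rewrite -!sum_exch -sumrB -big_split; apply: eq_bigr => b _ /=.
rewrite /nZ01 /nZb /cov /grad10 /grad01 /= sum_mulNl; ring.
Qed.

Lemma sublap_fconj F x : sublap (fconj F) x = sublap F x.
Proof.
rewrite !sublapE /=.
under [\sum_(i < n) (\sum_(j < n) - fP F i j j) * _]eq_bigr do rewrite sumrN.
under [\sum_(i < n) (\sum_(j < n) - fQ F j i j) * _]eq_bigr do rewrite sumrN.
rewrite !sum_mulNl.
under eq_bigr do rewrite addrC.
ring.
Qed.

(** By [nT_grad] and [curvT0], T can be moved through f_{b bbar} with only terms in [fN] left over,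
    and these cancel in the trace. The first half is proved for an arbitrary frame G so that the
    conjugate frame supplies the second. *)
Lemma T_sublap F x : fT F (sublap F x) = sublap F (fT F x).
Proof.
have H G : \sum_b fT G (nZb G b (grad10 G x) b) = \sum_b nZb G b (grad10 G (fT G x)) b.
  have e b : fT G (nZb G b (grad10 G x) b) = nZb G b (grad10 G (fT G x)) b
      - \sum_d fN G d b * nZb G d (grad10 G x) b + \sum_c fN G b c * nZb G b (grad10 G x) c.
    have -> : nZb G b (grad10 G (fT G x)) b = nZb G b (nT G (grad10 G x)) b.
      by apply: eq_cov => c; rewrite nT_grad.
    have /eqP := comm_nT_nZb G b (grad10 G x) b; rewrite subr_eq => /eqP.
    rewrite [in X in _ - X]big1 => [|c _]; last by rewrite curvT0 mul0r.
    rewrite {1}/nT {1}/cov => /eqP; rewrite subr_eq => /eqP ->; ring.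
  under eq_bigr do rewrite e.
  rewrite big_split sumrB /= [\sum_(i < n) \sum_(d < n) fN G d i * _]exchange_big /=.
  by rewrite subrK.
rewrite /sublap (der_sum _ (der_fT F)); under eq_bigr do rewrite (derD _ _ (der_fT F)).
rewrite big_split [RHS]big_split; congr (_ + _); first exact: H.
exact: (H (fconj F)).
Qed.

Lemma sublapM F x y : sublap F (x * y) = sublap F x * y + x * sublap F y
  + \sum_b (fZ F b x * fZb F b y + fZb F b x * fZ F b y) *+ 2.
Proof.
rewrite !sublapE.
have -> : \sum_b (fZb F b (fZ F b (x * y)) + fZ F b (fZb F b (x * y))) =
    (\sum_b (fZb F b (fZ F b x) + fZ F b (fZb F b x))) * y
    + x * (\sum_b (fZb F b (fZ F b y) + fZ F b (fZb F b y)))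
    + \sum_b (fZ F b x * fZb F b y + fZb F b x * fZ F b y) *+ 2.
  rewrite big_distrl big_distrr -!big_split; apply: eq_bigr => b _ /=.
  rewrite !(derM _ _ (der_fZ F b), derM _ _ (der_fZb F b), derD _ _ (der_fZ F b), derD _ _ (der_fZb F b)).
  ring.
have H (W : 'I_n -> A -> A) q : (forall c, derivation (W c)) ->
    \sum_c q c * W c (x * y) = (\sum_c q c * W c x) * y + x * \sum_c q c * W c y.
  move=> dW; rewrite big_distrl big_distrr -big_split; apply: eq_bigr => c _ /=.
  by rewrite (derM _ _ (dW c)); ring.
rewrite (H _ _ (der_fZ F)) (H _ _ (der_fZb F)); ring.
Qed.

Lemma fpairC u v : fpair u v = fpair v u.
Proof. by apply: eq_bigr => a _; rewrite mulrC. Qed.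

Lemma fpair_rough_lap F u v : fpair (rough_lap F u) v =
  \sum_b (fpair (nZb F b (nZ F b u)) v + fpair (nZ F b (nZb F b u)) v)
  - \sum_c (\sum_b fQ F b c b) * fpair (nZ F c u) v
  + \sum_c (\sum_b fP F c b b) * fpair (nZb F c u) v.
Proof.
have H (q : 'I_n -> A) (w : 'I_n -> 'I_n -> A) :
    \sum_c q c * fpair (w c) v = \sum_a (\sum_c q c * w c a) * v a.
  rewrite /fpair; under eq_bigr do rewrite big_distrr.
  rewrite exchange_big; apply: eq_bigr => a _; rewrite big_distrl.
  by apply: eq_bigr => c _ /=; rewrite mulrA.
rewrite (H _ (fun c => nZ F c u)) (H _ (fun c => nZb F c u)) /fpair.
under [in RHS]eq_bigr do rewrite -big_split.
rewrite exchange_big -sumrB -big_split; apply: eq_bigr => a _ /=.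
rewrite /rough_lap mulrDl mulrBl big_distrl; congr (_ - _ + _).
by apply: eq_bigr => b _ /=; rewrite mulrDl.
Qed.

Lemma Z_fpair F b u v : fZ F b (fpair u v) = fpair (nZ F b u) v + fpair u (nZ01 F b v).
Proof. by rewrite /fpair (cov_fpair (fun a c => fP F a c b) _ _ (der_fZ F b)) big_split. Qed.

Lemma Zb_fpair F b u v : fZb F b (fpair u v) = fpair (nZb F b u) v + fpair u (nZb01 F b v).
Proof. by rewrite /fpair (cov_fpair (fun a c => fQ F a c b) _ _ (der_fZb F b)) big_split. Qed.

(** The pairing is parallel, so the Leibniz rule holds with covariant derivatives; the cross terms
    become the squared Hessian norms of the Bochner identity. *)
Lemma sublap_fpair F u v : sublap F (fpair u v) =
  fpair (rough_lap F u) v + fpair u (rough_lap (fconj F) v)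
  + \sum_b (fpair (nZ F b u) (nZb01 F b v) + fpair (nZb F b u) (nZ01 F b v)) *+ 2.
Proof.
rewrite sublapE [fpair u (rough_lap _ _)]fpairC !fpair_rough_lap /=.
have H b : fZb F b (fZ F b (fpair u v)) + fZ F b (fZb F b (fpair u v)) =
  (fpair (nZb F b (nZ F b u)) v + fpair (nZ F b (nZb F b u)) v)
  + (fpair (nZ01 F b (nZb01 F b v)) u + fpair (nZb01 F b (nZ01 F b v)) u)
  + (fpair (nZ F b u) (nZb01 F b v) + fpair (nZb F b u) (nZ01 F b v)) *+ 2.
  rewrite Z_fpair Zb_fpair (derD _ _ (der_fZ F b)) (derD _ _ (der_fZb F b)) !Z_fpair !Zb_fpair.
  rewrite ![fpair u _]fpairC; ring.
under eq_bigr do rewrite H.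
rewrite !big_split /=.
under [\sum_i _ * fZ F i _]eq_bigr do rewrite Z_fpair mulrDr.
under [\sum_i _ * fZb F i _]eq_bigr do rewrite Zb_fpair mulrDr.
under [\sum_(i < n) (\sum_(j < n) - fP F i j j) * _]eq_bigr do rewrite sumrN.
under [\sum_(i < n) (\sum_(j < n) - fQ F j i j) * _]eq_bigr do rewrite sumrN.
rewrite !sum_mulNl !big_split /=.
under [\sum_i _ * fpair u (nZ01 F i v)]eq_bigr do rewrite fpairC.
under [\sum_i _ * fpair u (nZb01 F i v)]eq_bigr do rewrite fpairC.
rewrite /nZ01 /nZb01; ring.
Qed.

(** The conjugate frame has the formally conjugate curvature, so this is the Hermitian symmetry of
    the curvature. *)
Lemma curv_fconj F b a r s : curv (fconj F) b a r s = curv F a b s r.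
Proof.
rewrite /curv /om_br /= (derN _ (der_fZ F s)) (derN _ (der_fZb F r)) eq_sym.
under [\sum_d - fP F d r s * _]eq_bigr do rewrite mulrNN.
under [\sum_d - fQ F s d r * _]eq_bigr do rewrite mulrNN.
rewrite (_ : \sum_c (- fQ F c b r * _ - _) =
  \sum_c (fP F a c s * fQ F c b r - fQ F a c r * fP F c b s)); first by ring.
by apply: eq_bigr => c _; ring.
Qed.

(** Write t = i Z_a f_0. The part with the barred derivative outermost is a trace of f_{b a bbar};
    it yields the Ricci term and (n + 1) t. The other part commutes (0,1)-derivatives, costs no
    curvature as [curv20] vanishes, and yields t. Since Z_a of the sublaplacian accounts for n t,
    exactly 2 t remains. *)
Lemma rough_lap_grad F f a : rough_lap F (grad10 F f) a =
  fZ F a (sublap F f) + fi F * fZ F a (fT F f) *+ 2 + \sum_c ric F a c * grad10 F f c.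
Proof.
have [B1 B2] := bianchi F.
set v := grad01 F f; set u := grad10 F f; set t := fi F * fZ F a (fT F f).
have e1 : \sum_b nZb F b (nZ F b u) a - \sum_c (\sum_b fQ F b c b) * nZ F c u a =
    \sum_b nZ01 F a (nZ01 F b v) b - \sum_b \sum_c fP F b c a * nZ01 F c v b
    + t *+ n + t + \sum_c ric F a c * u c.
  transitivity (\sum_b third F f b a b).
    by rewrite -sum_exch -sumrB; apply: eq_bigr => b _; rewrite third_sym.
  under eq_bigr do rewrite thirdE.
  (* Here s is contracted with the lower matrix index, whereas Ricci traces the matrix indices; the
     Bianchi identity of the conjugate frame identifies the two traces. *)
  have -> : \sum_c ric F a c * u c = \sum_b \sum_c curv F b c a b * u c.
    rewrite sum_exch; apply: eq_bigr => c _; congr (_ * _); apply: eq_bigr => b _.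
    by have := (bianchi (fconj F)).1 b c b a; rewrite !curv_fconj.
  rewrite !big_split /= sumrN.
  have -> : \sum_b fi F * ((b == b)%:R * fZ F a (fT F f) + (a == b)%:R * fZ F b (fT F f)) =
      t *+ n + t.
    under eq_bigr do rewrite eqxx mul1r mulrDr.
    rewrite big_split sumr_const card_ord; congr (_ + _).
    rewrite -[RHS](sum_delta (fun b => fi F * fZ F b (fT F f)) a).
    by apply: eq_bigr => b _; rewrite eq_sym; ring.
  rewrite !sumrN -/u -/v; ring.
have e2 : \sum_b nZ F b (nZb F b u) a + \sum_c (\sum_b fP F c b b) * nZb F c u a =
    \sum_b nZ01 F a (nZ01 F b v) b - \sum_b \sum_c fP F b c a * nZ01 F c v b + t.
  transitivity (\sum_b (nZ01 F b (nZ01 F a v) b + (fi F * fZ F b (fT F f)) * (b == a)%:R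
      - \sum_c fP F a c b * nZ01 F c v b)).
    have -> : \sum_c (\sum_b fP F c b b) * nZb F c u a =
        \sum_b (\sum_c fP F c b b * nZ01 F a v c + fP F a b b * (fi F * fT F f)).
      rewrite big_split sum_exch /= -big_distrl /=.
      rewrite -[X in _ + X](sum_delta (fun c => (\sum_b fP F c b b) * (fi F * fT F f)) a).
      by rewrite -big_split; apply: eq_bigr => c _; rewrite hess_mixed eq_sym /=; ring.
    rewrite -big_split; apply: eq_bigr => b _ /=; rewrite nZ_nZb_grad.
    rewrite (nZ01E F b (nZ01 F a v)) eq_sym /v; ring.
  rewrite sumrB big_split sum_delta /=.
  have H b : nZ01 F b (nZ01 F a v) b = nZ01 F a (nZ01 F b v) b
      + \sum_c fP F a c b * nZ01 F c v b - \sum_c fP F b c a * nZ01 F c v b.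
    have /eqP := comm_nZ01_nZ01 F b a v b; rewrite subr_eq => /eqP ->.
    rewrite [X in _ - X + _]big1 => [|c _]; last by rewrite B2 oppr0 mul0r.
    by rewrite sum_mulBl; ring.
  under eq_bigr do rewrite H.
  by rewrite sumrB big_split /= /t; ring.
have e3 : \sum_b nZ01 F a (nZ01 F b v) b - \sum_b \sum_c fP F b c a * nZ01 F c v b =
    fZ F a (\sum_b nZ01 F b v b).
  rewrite (der_sum _ (der_fZ F a)) exchange_big -sumrB; apply: eq_bigr => b _ /=.
  by rewrite nZ01E; ring.
have e4 : fZ F a (sublap F f) = fZ F a (\sum_b nZ01 F b v b) *+ 2 + t *+ n.
  rewrite /sublap; under eq_bigr do rewrite hess_mixed eqxx mulr1.
  rewrite !big_split /= !(derD _ _ (der_fZ F a)) sumr_const card_ord -[_ *+ n]mulr_natr.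
  rewrite !(derM _ _ (der_fZ F a)) fZ_i (der_nat _ (der_fZ F a)) /t; ring.
rewrite e4 /rough_lap big_split /=.
have -> x y z w : x + y - z + w = (x - z) + (y + w) :> A by ring.
by rewrite e1 e2 e3; ring.
Qed.

(** [rough_lap_grad] is used for the frame and for its conjugate: i becomes - i, so the T-terms form
    a difference, while the two Ricci terms coincide by Hermitian symmetry. *)
Lemma bochner F f (u := grad10 F f) (v := grad01 F f) :
  sublap F (fpair u v) - fpair u (grad01 F (sublap F f)) - fpair v (grad10 F (sublap F f)) =
  (\sum_a \sum_c ric F a c * v a * u c) *+ 2
  + fi F * (fpair v (grad10 F (fT F f)) - fpair u (grad01 F (fT F f))) *+ 2
  + \sum_b (fpair (nZ F b u) (nZb01 F b v) + fpair (nZb F b u) (nZ01 F b v)) *+ 2.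
Proof.
have H G w : fpair (rough_lap G (grad10 G f)) w = fpair w (grad10 G (sublap G f))
    + fi G * fpair w (grad10 G (fT G f)) *+ 2 + \sum_a \sum_c ric G a c * w a * grad10 G f c.
  rewrite /fpair big_distrr -sumrMnl -!big_split; apply: eq_bigr => a _ /=.
  rewrite rough_lap_grad (_ : \sum_c _ * w a * _ = w a * \sum_c ric G a c * grad10 G f c).
    by rewrite /grad10; ring.
  by rewrite big_distrr; apply: eq_bigr => c _ /=; ring.
have e2 : fpair (rough_lap (fconj F) v) u = fpair u (grad01 F (sublap (fconj F) f))
    + (- fi F) * fpair u (grad01 F (fT F f)) *+ 2
    + \sum_a \sum_c ric (fconj F) a c * u a * v c := H (fconj F) u.
have e3 : \sum_a \sum_c ric (fconj F) a c * u a * v c = \sum_a \sum_c ric F a c * v a * u c.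
  rewrite exchange_big; apply: eq_bigr => a _; apply: eq_bigr => c _.
  have -> : ric (fconj F) c a = ric F a c by apply: eq_bigr => b _; rewrite curv_fconj.
  by rewrite mulrAC.
rewrite sublap_fconj e3 in e2.
rewrite sublap_fpair [fpair u (rough_lap _ _)]fpairC e2 (H F v); ring.
Qed.

Lemma sublapD F x y : sublap F (x + y) = sublap F x + sublap F y.
Proof.
have H (W : 'I_n -> A -> A) q : (forall c, derivation (W c)) ->
    \sum_c q c * W c (x + y) = \sum_c q c * W c x + \sum_c q c * W c y.
  by move=> dW; rewrite -big_split; apply: eq_bigr => c _; rewrite (derD _ _ (dW c)) mulrDr.
rewrite !sublapE (H _ _ (der_fZ F)) (H _ _ (der_fZb F)).
have -> : \sum_b (fZb F b (fZ F b (x + y)) + fZ F b (fZb F b (x + y))) =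
    \sum_b (fZb F b (fZ F b x) + fZ F b (fZb F b x))
    + \sum_b (fZb F b (fZ F b y) + fZ F b (fZb F b y)).
  rewrite -big_split; apply: eq_bigr => b _ /=.
  rewrite !(derD _ _ (der_fZ F b), derD _ _ (der_fZb F b)); ring.
ring.
Qed.

(** Gamma in complex form: the mixed products survive, with factor 2, when e_a = Z_a + conj Z_a and
    e_{n+a} = i (Z_a - conj Z_a) are expanded. *)
Definition carre F x y := \sum_a (fZ F a x * fZb F a y + fZb F a x * fZ F a y) *+ 2.

Lemma carreDr F x y z : carre F x (y + z) = carre F x y + carre F x z.
Proof.
rewrite /carre -big_split; apply: eq_bigr => a _ /=.
by rewrite (derD _ _ (der_fZ F a)) (derD _ _ (der_fZb F a)); ring.
Qed.

(** As L is twice [sublap], the left side is Gamma_2(f,f); the factor 4 comes from Gamma(f,f) = 4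
    sum u_a v_a. *)
Lemma gamma2E F f (u := grad10 F f) (v := grad01 F f) :
  sublap F (carre F f f) - carre F f (sublap F f) *+ 2 =
  ((\sum_a \sum_c ric F a c * v a * u c) *+ 2
  + fi F * (fpair v (grad10 F (fT F f)) - fpair u (grad01 F (fT F f))) *+ 2
  + \sum_b (fpair (nZ F b u) (nZb01 F b v) + fpair (nZb F b u) (nZ01 F b v)) *+ 2) *+ 4.
Proof.
rewrite -bochner -/u -/v.
have -> : carre F f f = fpair u v + fpair u v + (fpair u v + fpair u v).
  by rewrite /carre /fpair -!big_split; apply: eq_bigr => a _ /=; rewrite /u /v /grad10 /grad01; ring.
have -> : carre F f (sublap F f) = (fpair u (grad01 F (sublap F f)) + fpair v (grad10 F (sublap F f))) *+ 2.
  by rewrite /carre /fpair -big_split -sumrMnl.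
rewrite !sublapD; ring.
Qed.

Lemma gammaZ2E F f : sublap F (fT F f * fT F f) - fT F f * fT F (sublap F f) *+ 2 =
  fpair (grad10 F (fT F f)) (grad01 F (fT F f)) *+ 4.
Proof.
rewrite sublapM T_sublap.
have -> : \sum_b (fZ F b (fT F f) * fZb F b (fT F f) + fZb F b (fT F f) * fZ F b (fT F f)) *+ 2 =
    fpair (grad10 F (fT F f)) (grad01 F (fT F f)) *+ 4.
  by rewrite /fpair -sumrMnl; apply: eq_bigr => b _; rewrite /grad10 /grad01; ring.
ring.
Qed.

(** The T-component is tensorial in x and y; derivatives of the coefficients go only into x' and y',
    which stay existential. This gives the Levi form of a section with nonconstant coefficients. *)
Lemma frame_bracket F (x y : 'I_n -> A) : exists x' y', forall f,
  \sum_a x a * fZ F a (\sum_c y c * fZb F c f) - \sum_c y c * fZb F c (\sum_a x a * fZ F a f) =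
  \sum_c x' c * fZ F c f + \sum_c y' c * fZb F c f - fi F * fpair x y * fT F f.
Proof.
exists (fun b => - \sum_c y c * fZb F c (x b) - \sum_a \sum_c x a * y c * fQ F a b c).
exists (fun b => \sum_a x a * fZ F a (y b) - \sum_a \sum_c x a * y c * fP F b c a) => f.
have H1 (X Y : 'I_n -> A -> A) (z w : 'I_n -> A) : (forall a, derivation (X a)) ->
    \sum_a z a * X a (\sum_c w c * Y c f) =
    \sum_c (\sum_a z a * X a (w c)) * Y c f + \sum_a \sum_c z a * w c * X a (Y c f).
  move=> dX; rewrite -sum_exch -big_split; apply: eq_bigr => a _ /=.
  rewrite (der_sum _ (dX a)) big_distrr -big_split; apply: eq_bigr => c _ /=.
  by rewrite (derM _ _ (dX a)); ring.
have H3 (G : 'I_n -> 'I_n -> 'I_n -> A) (Y : 'I_n -> A -> A) :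
    \sum_b (\sum_a \sum_c x a * y c * G a b c) * Y b f =
    \sum_a \sum_c x a * y c * \sum_b G a b c * Y b f.
  under eq_bigr do rewrite big_distrl.
  rewrite exchange_big; apply: eq_bigr => a _ /=.
  under eq_bigr do rewrite big_distrl.
  rewrite exchange_big; apply: eq_bigr => c _ /=; rewrite big_distrr.
  by apply: eq_bigr => b _ /=; rewrite mulrA.
rewrite (H1 _ _ _ _ (der_fZ F)) (H1 _ _ _ _ (der_fZb F)).
rewrite [\sum_c (- _ - _) * _]sum_mulBl [\sum_c (- _) * _]sum_mulNl [\sum_c (_ - _) * fZb F c f]sum_mulBl.
rewrite (H3 (fun a b c => fQ F a b c)) (H3 (fun a b c => fP F b c a)).
have H2 : \sum_a \sum_c x a * y c * fZ F a (fZb F c f) =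
    \sum_a \sum_c y a * x c * fZb F a (fZ F c f)
    - \sum_a \sum_c x a * y c * (\sum_b fQ F a b c * fZ F b f)
    - \sum_a \sum_c x a * y c * (\sum_b fP F b c a * fZb F b f)
    - fi F * fpair x y * fT F f.
  rewrite [\sum_a \sum_c y a * x c * _]exchange_big /=.
  rewrite [fi F * _]mulrC big_distrl big_distrl -!sumrB; apply: eq_bigr => a _ /=.
  rewrite -(sum_delta (fun c => x a * y c * fi F * fT F f) a) -!sumrB; apply: eq_bigr => c _ /=.
  have /eqP := brZZb F a c f; rewrite subr_eq => /eqP ->; rewrite [a == c]eq_sym; ring.
rewrite H2; ring.
Qed.
End Bochner.

(** * Smooth functions and cutoffs *)

(** The difference g - f vanishes near x, so the zero map is its differential there, and g is f plus
    that difference. *)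
Lemma near_eq_differentiable (R : realType) (V W : normedModType R) (f g : V -> W) (x : V) :
  (\near x, f x = g x) -> differentiable f x -> differentiable g x.
Proof.
move=> fg df.
have de : differentiable (g - f) x.
  apply/diff_locallyP.
  have e0 : (g - f) \o shift x = cst ((g - f) x) + (GRing.null_fun W : V -> W) +o_ (0 : V) id.
    apply/eqaddoP => _/posnumP[eps].
    have fg0 : \forall h \near (0 : V), f (h + x) = g (h + x).
      by have := fg; rewrite (near_shift 0 x) subr0.
    near=> h; rewrite /= !fctE /= (nbhs_singleton fg) subrr.
    rewrite -(near fg0 h) // subrr addr0 subr0 normr0.
    exact: mulr_ge0.
  have -> := @diff_unique _ V W (g - f) (@GRing.null_fun V W) x (@cst_continuous _ _ 0) e0.
  by split=> //; exact: cst_continuous.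
have -> : g = f + (g - f) by rewrite addrC subrK.
exact: differentiableD.
Unshelve. all: by end_near. Qed.

(** * Finite orders of differentiability on open sets of R^m *)

Section Ck.
Variables (R : realType) (m : nat).
Implicit Types (O : set 'rV[R]_m) (f g : 'rV[R]_m -> R).

Definition pd (i : 'I_m) f : 'rV[R]_m -> R :=
  fun x => 'D_(delta_mx 0 i : 'rV[R]_m) f x.

(** All iterated partial derivatives of order at most k are Frechet differentiable on O, one order
    more than C^k. Recursion on k gives products and compositions an induction. *)
Fixpoint Ck k O f : Prop :=
  (forall x, O x -> differentiable f x) /\
  if k is k'.+1 then forall i, Ck k' O (pd i f) else True.

(** In [iter_partial] the last index of the sequence is differentiated first, while [Ck] peels off
    the first derivative taken; hence [rcons]. *)
Lemma smooth_onP O f : smooth_on O f <-> forall k, Ck k O f.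
Proof.
split=> [sf k|].
  elim: k f sf => [|k IH] f sf /=; split=> //; [exact: (sf [::])|exact: (sf [::])|].
  move=> i; apply: IH => s x Ox; have := sf (rcons s i) x Ox.
  by rewrite /iter_partial foldr_rcons.
move=> Cf s; elim/last_ind: s f Cf => [|s i IH] f Cf x Ox; first by have [/(_ x Ox)] := Cf 0%N.
rewrite /iter_partial foldr_rcons; apply: (IH (pd i f)) => // k.
by have [_ /(_ i)] := Cf k.+1.
Qed.

Lemma Ck_diff k O f x : Ck k O f -> O x -> differentiable f x.
Proof. by case: k => [|k] [H _]; exact: H. Qed.

Lemma pd_ext O f g i x : open O -> (forall y, O y -> f y = g y) -> O x -> pd i f x = pd i g x.
Proof.
move=> oO fg Ox; apply: near_eq_derive.
by near=> y; apply: fg; near: y; exact: open_nbhs_nbhs.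
Unshelve. all: by end_near. Qed.

Lemma Ck_ext k O f g : open O -> (forall x, O x -> f x = g x) -> Ck k O f -> Ck k O g.
Proof.
move=> oO; elim: k f g => [|k IH] f g fg /= [df pf]; split=> //.
- move=> x Ox; apply: near_eq_differentiable (df x Ox).
  by near=> y; apply: fg; near: y; exact: open_nbhs_nbhs.
- move=> x Ox; apply: near_eq_differentiable (df x Ox).
  by near=> y; apply: fg; near: y; exact: open_nbhs_nbhs.
- by move=> i; apply: IH (pf i) => x Ox; exact: pd_ext Ox.
Unshelve. all: by end_near. Qed.

Lemma Ck_S k O f : Ck k.+1 O f -> Ck k O f.
Proof. by elim: k f => [|k IH] f /= [df H]; split=> // i; apply: IH. Qed.

Lemma Ck_cst k O (c : R) : Ck k O (cst c).
Proof.
elim: k c => [|k IH] c /=; split=> //.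
move=> i; rewrite (_ : pd i _ = cst 0) //.
by apply/funext => x; rewrite /pd derive_cst.
Qed.

Lemma CkD k O f g : open O -> Ck k O f -> Ck k O g -> Ck k O (fun x => f x + g x).
Proof.
move=> oO; elim: k f g => [|k IH] f g /= [df pf] [dg pg]; split=> //.
- by move=> x Ox; apply: differentiableD; [exact: df|exact: dg].
- by move=> x Ox; apply: differentiableD; [exact: df|exact: dg].
- move=> i; apply: (Ck_ext oO) (IH _ _ (pf i) (pg i)) => x Ox.
  by rewrite /pd deriveD //; apply: diff_derivable; [exact: df|exact: dg].
Qed.

Lemma CkM k O f g : open O -> Ck k O f -> Ck k O g -> Ck k O (fun x => f x * g x).
Proof.
move=> oO; elim: k f g => [|k IH] f g.
  move=> /= [df pf] [dg pg]; split=> // x Ox.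
  by apply: differentiableM; [exact: df|exact: dg].
move=> Cf Cg; have [df pf] := Cf; have [dg pg] := Cg; split.
  by move=> x Ox; apply: differentiableM; [exact: df|exact: dg].
move=> i; apply: (Ck_ext oO) (CkD oO (IH _ _ (Ck_S Cf) (pg i)) (IH _ _ (Ck_S Cg) (pf i))) => x Ox.
by rewrite /pd deriveM //; apply: diff_derivable; [exact: df|exact: dg].
Qed.

(** The whole sequence of derivatives is given at once, so that the chain rule can step from [hn n]
    to [hn n.+1]. *)
Definition smooth1 (h : R -> R) := exists hn : nat -> R -> R,
  hn 0%N = h /\ forall n t, is_derive t (1 : R) (hn n) (hn n.+1 t).

(** By the chain rule a partial derivative of h_n(f) is h_{n+1}(f) times one of f, so the induction
    on k must range over all n. *)
Lemma Ck_comp k O f (h : nat -> R -> R) n : open O ->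
  (forall n t, is_derive t (1 : R) (h n) (h n.+1 t)) ->
  Ck k O f -> Ck k O (fun x => h n (f x)).
Proof.
move=> oO dh; elim: k f n => [|k IH] f n Cf.
  split=> // x Ox; apply: differentiable_comp; first exact: Ck_diff Cf Ox.
  by apply/derivable1_diffP; have [] := dh n (f x).
have dcomp x : O x -> differentiable (h n \o f) x.
  move=> Ox; apply: differentiable_comp; first exact: Ck_diff Cf Ox.
  by apply/derivable1_diffP; have [] := dh n (f x).
split=> // i; have [_ pf] := Cf.
apply: (Ck_ext oO) (CkM oO (IH _ n.+1 (Ck_S Cf)) (pf i)) => x Ox.
have [dv hv] := dh n (f x).
have df := Ck_diff Cf Ox.
rewrite /pd (deriveE _ df) (deriveE _ (dcomp x Ox)) (diff_comp df) /=; last exact/derivable1_diffP.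
by rewrite deriv1E // derive1E hv mulrC.
Qed.

End Ck.

(** * The flat function exp(-1/t) *)

Section Flat.
Variable R : realType.
Implicit Types (P : {poly R}) (s t : R).

(** A family closed under differentiation that contains exp(-1/t), extended by zero, as the case P =
    1. *)
Definition flat P t := if 0 < t then P.[t^-1] * expR (- t^-1) else 0.

(** One term of the exponential series bounds s^j exp(-s) by j!. The exponent k is free because
    removing a factor X from P raises it by one. *)
Lemma flat_bound P k : exists C, forall s, 0 < s -> `|P.[s]| * s ^+ k * expR (- s) <= C.
Proof.
have B j s : 0 < s -> s ^+ j * expR (- s) <= j`!%:R.
  move=> s0; rewrite expRN ler_pdivrMr ?expR_gt0 //.
  case: j => [|j]; first by rewrite expr0 fact0 mul1r -expR0 ler_expR ltW.
  rewrite mulrC -ler_pdivrMr ?ltr0n ?fact_gt0 //.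
  by apply: le_trans (expR_ge1Dxn j (ltW s0)); rewrite lerDr.
elim/poly_ind: P k => [|P c IH] k; first by exists 0 => s _; rewrite horner0 normr0 !mul0r.
have [C HC] := IH k.+1; exists (C + `|c| * k`!%:R) => s s0.
rewrite hornerMXaddC.
apply: (@le_trans _ _ ((`|P.[s]| * s + `|c|) * s ^+ k * expR (- s))).
  rewrite ler_wpM2r ?expR_ge0 // ler_wpM2r ?(exprn_ge0 _ (ltW s0)) //.
  by apply: le_trans (ler_normD _ _) _; rewrite normrM (gtr0_norm s0).
rewrite !mulrDl; apply: lerD; first by rewrite -[_ * s * _]mulrA -exprS; exact: HC.
by rewrite -mulrA ler_wpM2l // B.
Qed.

Lemma flat_quadratic P : exists2 C, 0 <= C & forall t, `|flat P t| <= C * t ^+ 2.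
Proof.
have [C HC] := flat_bound P 2.
have C0 : 0 <= C.
  by apply: le_trans (HC 1 ltr01); rewrite !mulr_ge0 ?expR_ge0 ?expr1n.
exists C => // t; rewrite /flat; case: ifPn => [t0|_]; last by rewrite normr0 mulr_ge0 ?sqr_ge0.
have ti : 0 < t^-1 by rewrite invr_gt0.
have := HC _ ti; rewrite normrM [`|expR _|]gtr0_norm ?expR_gt0 // exprVn mulrAC.
by rewrite ler_pdivrMr ?exprn_gt0.
Qed.

(** For t > 0, differentiating P(1/t) exp(-1/t) gives (P - P')(1/t) t^-2 exp(-1/t), whence the
    polynomial. At t = 0 the quadratic bound forces derivative zero. *)
Lemma flat_derive P t : is_derive t (1 : R) (flat P) (flat ((P - P^`()) * 'X^2) t).
Proof.
have [t0|t0|t0] := ltgtP t 0.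
- rewrite {2}/flat ltNge (ltW t0) /=.
  apply: (@near_eq_is_derive _ _ _ (cst 0)) => //.
  by near=> s; rewrite /flat ltNge ltW //; near: s; exact: lt_nbhsl.
- have tN0 : t != 0 by rewrite gt_eqF.
  apply: (@near_eq_is_derive _ _ _ (fun s => P.[s^-1] * expR (- s^-1))).
    by near=> s; rewrite /flat (_ : 0 < s) //; near: s; exact: lt_nbhsr.
  have dV : is_derive t (1 : R) (fun s : R => s^-1) (- t ^- 2).
    have dv := @derivable_id R R t 1.
    split; first exact: (derivableV (f := id)).
    by rewrite (deriveV (f := id)) // derive_id scaler1.
  have dVN : is_derive t (1 : R) (fun s : R => - s^-1) (t ^- 2).
    by apply: is_derive_eq; rewrite ?opprK.
  have dP : is_derive t (1 : R) (fun s => P.[s^-1]) (P^`().[t^-1] * (- t ^- 2)).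
    exact: (is_derive1_comp (f := horner P)).
  have dE : is_derive t (1 : R) (fun s => expR (- s^-1)) (expR (- t^-1) * t ^- 2).
    exact: (is_derive1_comp (f := expR)).
  have dPE := @is_deriveM _ _ _ _ _ _ _ _ dP dE.
  apply: (is_derive_eq dPE).
  rewrite /flat t0 hornerM hornerXn hornerD hornerN /GRing.scale /= -exprVn; ring.
- have [C C0 HC] := flat_quadratic P.
  rewrite t0 {2}/flat ltxx.
  have g0 : flat P 0 = 0 by rewrite /flat ltxx.
  (* The difference quotient is at most C |h|; C + 1 replaces C so as to divide by a positive
     constant. *)
  have lim0 : h^-1 *: (flat P (h *: (1 : R) + 0) - flat P 0) @[h --> (0 : R)^'] --> (0 : R).
    apply/cvgr0Pnorm_le => e e0.
    have C1 : 0 < C + 1 by rewrite ltr_wpDl.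
    near=> h.
    have hN0 : h != 0 by near: h; exact: nbhs_dnbhs_neq.
    rewrite g0 subr0 addr0 /GRing.scale /= mulr1 normrM normfV.
    rewrite ler_pdivrMl ?normr_gt0 //; apply: le_trans (HC h) _.
    rewrite -real_normK ?num_real // expr2 mulrA mulrC ler_wpM2l //.
    apply: (@le_trans _ _ ((C + 1) * `|h|)); first by rewrite ler_wpM2r // lerDl.
    rewrite -ler_pdivlMl //; apply/ltW; near: h; apply: dnbhs0_lt.
    by rewrite mulr_gt0 ?invr_gt0.
  split; first by apply/cvg_ex; exists 0.
  exact: (cvg_lim _ lim0).
Unshelve. all: by end_near. Qed.

Lemma smooth1_flat : smooth1 (flat 1).
Proof.
exists (fun n => flat (iter n (fun P => (P - P^`()) * 'X^2) 1)); split=> // n t.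
exact: flat_derive.
Qed.

End Flat.

(** * Smooth functions on a manifold and bump functions *)

Section Smooth.
Variables (R : realType) (m : nat) (M : manifold R m).
Implicit Types (V W : set M) (f g : M -> R) (c : chart R m M).

Lemma chart_image_open c V : open V -> open (chart_map c @` (V `&` dom c)).
Proof.
move=> oV.
have cont : {in cod c, continuous (chart_inv c)}.
  by rewrite -(continuous_open_subspace _ (@cod_open _ _ _ c)); exact: chart_inv_cont.
rewrite openE => _ [p [Vp cp] <-].
have yc := chart_map_cod cp.
have c1 : \forall y \near chart_map c p, V (chart_inv c y).
  have := cont (chart_map c p); rewrite inE => /(_ yc); apply.
  by rewrite chart_mapK //; exact: open_nbhs_nbhs.
have c2 : \forall y \near chart_map c p, cod c y.
  by apply: open_nbhs_nbhs; split=> //; exact: cod_open.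
near=> y.
have cy : cod c y by near: y.
exists (chart_inv c y); last exact: chart_invK.
by split; [near: y|exact: chart_inv_dom].
Unshelve. all: by end_near. Qed.

Lemma smooth_fun_ext V f g : open V -> (forall p, V p -> f p = g p) ->
  smooth_fun V f -> smooth_fun V g.
Proof.
move=> oV fg sf c ac; have oI := chart_image_open (c := c) oV.
apply/smooth_onP => k; apply: (Ck_ext oI) ((smooth_onP _ _).1 (sf c ac) k).
by move=> _ [p [Vp cp] <-] /=; rewrite chart_mapK // fg.
Qed.

Lemma smooth_fun_sub V W f : W `<=` V -> smooth_fun V f -> smooth_fun W f.
Proof. by move=> WV sf c ac s _ [p [Wp cp] <-]; apply: sf => //; exists p => //; split=> //; exact: WV. Qed.

Lemma smooth_fun_local V f :
  (forall p, V p -> exists W, [/\ open W, W p & smooth_fun W f]) -> smooth_fun V f.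
Proof.
by move=> H c ac s _ [p [Vp cp] <-]; have [W [oW Wp]] := H p Vp; apply=> //; exists p.
Qed.

Lemma smooth_fun_cst V (a : R) : smooth_fun V (cst a).
Proof. by move=> c ac; apply/smooth_onP => k; exact: Ck_cst. Qed.

Lemma smooth_funD V f g : open V -> smooth_fun V f -> smooth_fun V g ->
  smooth_fun V (fun p => f p + g p).
Proof.
move=> oV sf sg c ac; apply/smooth_onP => k.
by apply: (CkD (chart_image_open (c := c) oV)); [exact: (smooth_onP _ _).1 (sf c ac) k|
  exact: (smooth_onP _ _).1 (sg c ac) k].
Qed.

Lemma smooth_funM V f g : open V -> smooth_fun V f -> smooth_fun V g ->
  smooth_fun V (fun p => f p * g p).
Proof.
move=> oV sf sg c ac; apply/smooth_onP => k.
by apply: (CkM (chart_image_open (c := c) oV)); [exact: (smooth_onP _ _).1 (sf c ac) k|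
  exact: (smooth_onP _ _).1 (sg c ac) k].
Qed.

Lemma smooth_funN V f : open V -> smooth_fun V f -> smooth_fun V (fun p => - f p).
Proof.
move=> oV sf; apply: (smooth_fun_ext oV _ (smooth_funM oV (smooth_fun_cst (-1)) sf)).
by move=> p _; rewrite /= mulN1r.
Qed.

Lemma smooth_fun_comp V f (h : R -> R) : open V -> smooth1 h -> smooth_fun V f ->
  smooth_fun V (fun p => h (f p)).
Proof.
move=> oV [hn [<- dh]] sf c ac; apply/smooth_onP => k.
exact: (Ck_comp 0 (chart_image_open (c := c) oV) dh ((smooth_onP _ _).1 (sf c ac) k)).
Qed.

Lemma smooth_fun_prod V (I : finType) (F : I -> M -> R) : open V ->
  (forall i, smooth_fun V (F i)) -> smooth_fun V (fun p => \prod_i F i p).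
Proof.
move=> oV sF; elim: (index_enum I) => [|i r IH].
  by apply: (smooth_fun_ext oV _ (smooth_fun_cst 1)) => p _; rewrite big_nil.
by apply: (smooth_fun_ext oV _ (smooth_funM oV (sF i) IH)) => p _; rewrite big_cons.
Qed.

Lemma smooth_fun_coord c i : atlas c -> smooth_fun (dom c) (fun p => chart_map c p 0 i).
Proof. by move=> ac b ab; rewrite setIC; exact: atlas_smooth. Qed.

(** A product of flat functions of the coordinates, positive exactly inside a small cube around the
    point, normalized at the centre and extended by zero outside the chart. *)
Lemma smooth_bump V p : open V -> V p -> exists2 chi : M -> R, smooth_fun setT chi & chi p = 1 /\
  exists K, [/\ closed K, K `<=` V & forall q, ~ K q -> chi q = 0].
Proof.
move=> oV Vp; have [c ac cp] := atlas_cover p.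
have oO := chart_image_open (c := c) oV.
set O := chart_map c @` _ in oO; set y0 := chart_map c p.
have : nbhs y0 O by apply: open_nbhs_nbhs; split=> //; exists p.
move=> /nbhs_ballP [r /= r0 rO].
(* Half the radius keeps the closed cube inside the open sup-norm ball, hence inside the chart image
   of V. *)
pose B := [set y : 'rV[R]_m | forall i, `[y0 0 i - r / 2, y0 0 i + r / 2]%classic (y 0 i)].
have BO : B `<=` O.
  move=> y By; apply: rO; split=> // i j; rewrite ord1 /ball /=.
  by have := By j; rewrite /= in_itv /= => /andP[h1 h2]; rewrite ltr_norml; apply/andP; split; lra.
have Bc : B `<=` cod c by move=> y /BO [q [_ cq] <-]; exact: chart_map_cod.
pose K := chart_inv c @` B.
have KV : K `<=` V `&` dom c by move=> _ [y /BO [q [Vq cq] <-] <-]; rewrite chart_mapK.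
have cK : closed K.
  apply: compact_closed; first exact: manifold_hausdorff.
  apply: continuous_compact.
    exact: continuous_subspaceW Bc (@chart_inv_cont _ _ _ c).
  exact: (@rV_compact R _ (fun i => `[y0 0 i - r / 2, y0 0 i + r / 2]%classic) (fun i => @segment_compact _ _ _)).
pose h i q := flat 1 (r / 2 - (chart_map c q 0 i - y0 0 i)) * flat 1 (r / 2 + (chart_map c q 0 i - y0 0 i)).
pose e := \prod_(i < m) (flat 1 (r / 2) * flat 1 (r / 2) : R).
have e0 : e != 0.
  apply/prodf_neq0 => i _.
  by rewrite /flat divr_gt0 // hornerC mul1r mulf_neq0 // gt_eqF // expR_gt0.
pose chi q := if `[< dom c q >] then e^-1 * \prod_i h i q else 0.
have chi0 q : ~ K q -> chi q = 0.
  move=> nK; rewrite /chi; case: asboolP => // cq; apply/eqP; apply: contra_notT nK.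
  rewrite mulf_eq0 negb_or => /andP[_ /prodf_neq0 hN0].
  exists (chart_map c q); last exact: chart_mapK.
  move=> i /=; have := hN0 i isT; rewrite /h /flat in_itv /=.
  case: ifP => [h1|]; last by rewrite mul0r eqxx.
  by case: ifP => [h2 _|]; [apply/andP; split; lra|rewrite mulr0 eqxx].
exists chi; last first.
  split; last by exists K; split=> // q /KV [].
  rewrite /chi asboolT // -[RHS](mulVf e0); congr (_ * _); apply: eq_bigr => i _.
  by rewrite /h subrr subr0 addr0.
(* The chart domain and the complement of K cover M. That complement is open because K is compact
   and M is Hausdorff. *)
apply: smooth_fun_local => q _; have [cq|ncq] := pselect (dom c q).
  exists (dom c); split=> //; first exact: dom_open.
  have od := @dom_open _ _ _ c.
  apply: (smooth_fun_ext (f := fun q => e^-1 * \prod_i h i q) od) => [x cx|].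
    by rewrite /chi asboolT.
  apply: smooth_funM => //; first exact: smooth_fun_cst.
  apply: smooth_fun_prod => // i.
  have sx : smooth_fun (dom c) (fun q => chart_map c q 0 i - y0 0 i).
    by apply: smooth_funD => //; [exact: smooth_fun_coord|exact: smooth_fun_cst].
  apply: smooth_funM => //; apply: smooth_fun_comp => //; try exact: smooth1_flat.
    by apply: smooth_funD => //; [exact: smooth_fun_cst|exact: smooth_funN].
  by apply: smooth_funD => //; exact: smooth_fun_cst.
exists (~` K); split; [exact: closed_openC| by move=> /KV []|].
by apply: (smooth_fun_ext (f := cst 0)) => [|x /chi0|]; [exact: closed_openC|move=> ->|exact: smooth_fun_cst].
Qed.

End Smooth.

(** * Tangent vectors and the ring of smooth functions *)

Section ComplexCalculus.
Variables (R : realType) (m : nat) (M : manifold R m).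
Local Notation C := R[i].
Implicit Types (p q : M) (V W : set M) (f g : M -> C) (X Y : cfield M) (D : cvec M).

Lemma csmooth_ext V f g : open V -> (forall p, V p -> f p = g p) -> csmooth V f -> csmooth V g.
Proof.
by move=> oV fg [s1 s2]; split; [apply: smooth_fun_ext oV _ s1|apply: smooth_fun_ext oV _ s2]
  => p Vp; rewrite fg.
Qed.

Lemma csmooth_sub V W f : W `<=` V -> csmooth V f -> csmooth W f.
Proof. by move=> WV [s1 s2]; split; apply: smooth_fun_sub WV _. Qed.

Lemma csmooth_local V f :
  (forall p, V p -> exists W, [/\ open W, W p & csmooth W f]) -> csmooth V f.
Proof.
by move=> H; split; apply: smooth_fun_local => p /H [W [oW Wp [s1 s2]]]; exists W.
Qed.

Lemma csmooth_cst V (a : C) : csmooth V (cst a).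
Proof. by split; exact: smooth_fun_cst. Qed.

Lemma csmooth_real V (f : M -> R) : smooth_fun V f -> csmooth V (fun p => (f p)%:C%C).
Proof. by move=> sf; split=> //=; exact: smooth_fun_cst. Qed.

Lemma csmoothD V f g : open V -> csmooth V f -> csmooth V g -> csmooth V (fun p => f p + g p).
Proof.
move=> oV [f1 f2] [g1 g2]; split.
  by apply: smooth_fun_ext oV _ (smooth_funD oV f1 g1) => p _ /=; case: (f p) (g p) => [? ?] [].
by apply: smooth_fun_ext oV _ (smooth_funD oV f2 g2) => p _ /=; case: (f p) (g p) => [? ?] [].
Qed.

Lemma csmoothM V f g : open V -> csmooth V f -> csmooth V g -> csmooth V (fun p => f p * g p).
Proof.
move=> oV [f1 f2] [g1 g2]; split.
  apply: smooth_fun_ext oV _ (smooth_funD oV (smooth_funM oV f1 g1)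
    (smooth_funN oV (smooth_funM oV f2 g2))) => p _ /=; by case: (f p) (g p) => [? ?] [].
apply: smooth_fun_ext oV _ (smooth_funD oV (smooth_funM oV f1 g2) (smooth_funM oV f2 g1)) => p _ /=.
by case: (f p) (g p) => [? ?] [].
Qed.

Lemma csmooth_conj V f : open V -> csmooth V f -> csmooth V (fun p => ((f p)^*)%C).
Proof.
move=> oV [f1 f2]; split.
  by apply: smooth_fun_ext oV _ f1 => p _ /=; case: (f p).
by apply: smooth_fun_ext oV _ (smooth_funN oV f2) => p _ /=; case: (f p).
Qed.

Lemma csmooth_sum V (I : finType) (F : I -> M -> C) : open V ->
  (forall i, csmooth V (F i)) -> csmooth V (fun p => \sum_i F i p).
Proof.
move=> oV sF; elim: (index_enum I) => [|i r IH].
  by apply: csmooth_ext oV _ (csmooth_cst V 0) => p _; rewrite big_nil.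
by apply: csmooth_ext oV _ (csmoothD oV (sF i) IH) => p _; rewrite big_cons.
Qed.

Lemma smooth_nearI V f p : open V -> V p -> csmooth V f -> smooth_near p f.
Proof. by exists V. Qed.

Lemma near_witness p (P : M -> Prop) : (\forall q \near p, P q) ->
  exists W, [/\ open W, W p & forall q, W q -> P q].
Proof. by move=> H; have: nbhs p P := H; rewrite nbhsE => -[W [oW Wp] WP]; exists W. Qed.

Lemma smooth_near_ext p f g : (\near p, f p = g p) -> smooth_near p f -> smooth_near p g.
Proof.
move=> /near_witness [W [oW Wp fg]] [V [oV Vp] sf].
exists (V `&` W); first by split=> //; exact: openI.
by apply: csmooth_ext (openI oV oW) _ (csmooth_sub (@subIsetl _ _ _) sf) => q [_ /fg].
Qed.

Lemma smooth_near_conj p f : smooth_near p f -> smooth_near p (fun q => ((f q)^*)%C).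
Proof. by case=> V [oV Vp] sf; exists V => //; exact: csmooth_conj. Qed.

Lemma smooth_near_open p f : smooth_near p f -> \forall q \near p, smooth_near q f.
Proof. by case=> V [oV Vp] sf; apply: filterS (open_nbhs_nbhs (conj oV Vp)) => q Vq; exists V. Qed.

Lemma smooth_near_cst p (a : C) : smooth_near p (cst a).
Proof. by exists setT; [split=> //; exact: openT|exact: csmooth_cst]. Qed.

Lemma smooth_nearD p f g : smooth_near p f -> smooth_near p g -> smooth_near p (fun q => f q + g q).
Proof.
move=> [V [oV Vp] sf] [W [oW Wp] sg]; have oI := openI oV oW; exists (V `&` W) => //.
by apply: csmoothD => //; [apply: csmooth_sub sf|apply: csmooth_sub sg] => ? [].
Qed.

Lemma smooth_nearM p f g : smooth_near p f -> smooth_near p g -> smooth_near p (fun q => f q * g q).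
Proof.
move=> [V [oV Vp] sf] [W [oW Wp] sg]; have oI := openI oV oW; exists (V `&` W) => //.
by apply: csmoothM => //; [apply: csmooth_sub sf|apply: csmooth_sub sg] => ? [].
Qed.

Section Tangent.
Variables (p : M) (D : cvec M).
Hypothesis tD : tangent p D.

Lemma tan_near f g : (\near p, f p = g p) -> D f = D g.
Proof. by case: tD => H _ _ _; apply: H. Qed.

Lemma tanL (a : C) f g : smooth_near p f -> smooth_near p g ->
  D (fun q => a * f q + g q) = a * D f + D g.
Proof. by case: tD => _ H _ _; apply: H. Qed.

Lemma tanM f g : smooth_near p f -> smooth_near p g ->
  D (fun q => f q * g q) = D f * g p + f p * D g.
Proof. by case: tD => _ _ H _; apply: H. Qed.

Lemma tan_out f : ~ smooth_near p f -> D f = 0.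
Proof. by case: tD => _ _ _; apply. Qed.

Lemma tanD f g : smooth_near p f -> smooth_near p g -> D (fun q => f q + g q) = D f + D g.
Proof.
move=> sf sg; rewrite -[X in _ = X + _]mul1r -tanL //; congr D.
by apply/funext => q; rewrite mul1r.
Qed.

Lemma tan_cst (a : C) : D (cst a) = 0.
Proof.
have s1 := smooth_near_cst p 1; have s0 := smooth_near_cst p 0.
have D0 : D (cst 0) = 0.
  apply: (addrI (D (cst 0))); rewrite addr0 -tanD //; congr D.
  by apply/funext => q; rewrite /= addr0.
have D1 : D (cst 1) = 0.
  have := tanM s1 s1; rewrite mulr1 mul1r => e.
  by apply: (addrI (D (cst 1))); rewrite -e addr0; congr D; apply/funext => q; rewrite /= mulr1.
have := tanL a s1 s0; rewrite D0 D1 mulr0 addr0 => <-; congr D.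
by apply/funext => q; rewrite /= mulr1 addr0.
Qed.

Lemma tan_near_cst f (a : C) : (\near p, f p = a) -> D f = 0.
Proof. by move=> fa; rewrite (@tan_near f (cst a)) // tan_cst. Qed.

End Tangent.

Lemma tangent0 p : tangent p (@zerov _ _ M).
Proof. by split=> *; rewrite /zerov ?mulr0 ?mul0r ?addr0. Qed.

Lemma tangent_lin p (z : C) D1 D2 : tangent p D1 -> tangent p D2 ->
  tangent p (addv (scalev z D1) D2).
Proof.
move=> t1 t2; rewrite /addv /scalev; split=> [f g fg|a f g sf sg|f g sf sg|f nf].
- by rewrite (tan_near t1 fg) (tan_near t2 fg).
- by rewrite (tanL t1) // (tanL t2) //; ring.
- by rewrite (tanM t1) // (tanM t2) //; ring.
- by rewrite (tan_out t1) // (tan_out t2) // mulr0 addr0.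
Qed.

Lemma conj_conj f : (fun q => ((((f q)^*)%C)^*)%C) = f.
Proof. by apply/funext => q; rewrite conjcK. Qed.

Lemma tangent_conj p D : tangent p D -> tangent p (conjv D).
Proof.
move=> t; rewrite /conjv; split=> [f g fg|a f g sf sg|f g sf sg|f nf].
- by congr (_^*)%C; apply: (tan_near t); apply: filterS fg => q ->.
- rewrite (_ : (fun q => _) = fun q => a^*%C * (f q)^*%C + (g q)^*%C); last first.
    by apply/funext => q; rewrite rmorphD rmorphM.
  rewrite (tanL t); [|exact: smooth_near_conj..].
  by rewrite rmorphD rmorphM /= conjcK.
- rewrite (_ : (fun q => _) = fun q => (f q)^*%C * (g q)^*%C); last first.
    by apply/funext => q; rewrite rmorphM.
  rewrite (tanM t); [|exact: smooth_near_conj..].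
  by rewrite rmorphD !rmorphM /= !conjcK.
- by rewrite (tan_out t) ?rmorph0 // => /smooth_near_conj; rewrite conj_conj.
Qed.

Lemma conjvK D : conjv (conjv D) = D.
Proof. by apply/funext => f; rewrite /conjv conj_conj conjcK. Qed.

Lemma vfield_sub V W X : W `<=` V -> vfield V X -> vfield W X.
Proof.
move=> WV [t s]; split=> [p /WV /t //|V' f oV' V'W].
by apply: s => // q /V'W /WV.
Qed.

Lemma vfield_conj V X : vfield V X -> vfield V (conjf X).
Proof.
move=> [t s]; split=> [p Vp|W f oW WV sf]; first exact/tangent_conj/t.
by apply: csmooth_conj => //; apply: s => //; exact: csmooth_conj.
Qed.

Lemma vfield_smooth_near V X p f : open V -> vfield V X -> V p -> smooth_near p f ->
  smooth_near p (fun q => X q f).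
Proof.
move=> oV [_ s] Vp [W [oW Wp] sf]; exists (V `&` W); first by split=> //; exact: openI.
by apply: s; [exact: openI|exact: subIsetl|apply: csmooth_sub sf].
Qed.

Lemma near_open V p (P : M -> Prop) : open V -> V p -> (forall q, V q -> P q) -> \forall q \near p, P q.
Proof. by move=> oV Vp H; apply: filterS (open_nbhs_nbhs (conj oV Vp)). Qed.

Lemma bracketE V X Y p f : open V -> vfield V X -> vfield V Y -> V p -> smooth_near p f ->
  bracket X Y p f = X p (fun q => Y q f) - Y p (fun q => X q f).
Proof. by move=> oV vX vY Vp sf; rewrite /bracket asboolT. Qed.

(** The second-order terms cancel in the Leibniz rule. The rules for Y f hold near p, not only at p,
    so locality of X allows substituting them under X. *)
Lemma tangent_bracket V X Y p : open V -> vfield V X -> vfield V Y -> V p ->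
  tangent p (bracket X Y p).
Proof.
move=> oV vX vY Vp; have tX := vX.1 _ Vp; have tY := vY.1 _ Vp.
have sX f := @vfield_smooth_near V X p f oV vX Vp.
have sY f := @vfield_smooth_near V Y p f oV vY Vp.
have near2 (f g : M -> C) Z : vfield V Z -> (\near p, f p = g p) -> \near p, Z p f = Z p g.
  move=> vZ /near_witness [W [oW Wp fg]]; apply: (near_open (openI oV oW) (conj Vp Wp)) => q [Vq Wq].
  by apply: (tan_near (vZ.1 _ Vq)); apply: (near_open oW Wq).
have lin Z a f g : vfield V Z -> smooth_near p f -> smooth_near p g ->
    \forall q \near p, Z q (fun x => a * f x + g x) = a * Z q f + Z q g.
  move=> vZ /smooth_near_open sf /smooth_near_open sg; near=> q.
  have Vq : V q by near: q; exact: (near_open oV Vp).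
  by apply: (tanL (vZ.1 _ Vq)); near: q.
have mul Z f g : vfield V Z -> smooth_near p f -> smooth_near p g ->
    \forall q \near p, Z q (fun x => f x * g x) = Z q f * g q + f q * Z q g.
  move=> vZ /smooth_near_open sf /smooth_near_open sg; near=> q.
  have Vq : V q by near: q; exact: (near_open oV Vp).
  by apply: (tanM (vZ.1 _ Vq)); near: q.
split=> [f g fg|a f g sf sg|f g sf sg|f nf]; last by rewrite /bracket asboolF.
- have [sf|nf] := pselect (smooth_near p f).
    rewrite !(bracketE oV vX vY Vp) //; last exact: smooth_near_ext fg sf.
    by rewrite (tan_near tX (near2 _ _ _ vY fg)) (tan_near tY (near2 _ _ _ vX fg)).
  rewrite /bracket !asboolF // => /smooth_near_ext sg; apply: nf; apply: sg.
  by apply: filterS fg => q ->.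
- have sl : smooth_near p (fun q => a * f q + g q).
    by apply: smooth_nearD => //; apply: smooth_nearM => //; exact: smooth_near_cst.
  rewrite !(bracketE oV vX vY Vp) // (tan_near tX (lin _ a _ _ vY sf sg)).
  rewrite (tan_near tY (lin _ a _ _ vX sf sg)) (tanL tX) ?(tanL tY); auto.
  ring.
- have sl : smooth_near p (fun q => f q * g q) by exact: smooth_nearM.
  rewrite !(bracketE oV vX vY Vp) // (tan_near tX (mul _ _ _ vY sf sg)).
  rewrite (tan_near tY (mul _ _ _ vX sf sg)).
  rewrite (tanD tX) ?(tanD tY) ?(tanM tX) ?(tanM tY); auto using smooth_nearM.
  ring.
Unshelve. all: by end_near. Qed.

Lemma conj_bracket V X Y p : open V -> vfield V X -> vfield V Y -> V p ->
  conjv (bracket X Y p) = bracket (conjf X) (conjf Y) p.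
Proof.
move=> oV vX vY Vp; apply/funext => f; rewrite /conjv.
have [sf|nf] := pselect (smooth_near p f); last first.
  rewrite (tan_out (tangent_bracket oV vX vY Vp)).
    by rewrite conjc0 (tan_out (tangent_bracket oV (vfield_conj vX) (vfield_conj vY) Vp)).
  by move=> /smooth_near_conj; rewrite conj_conj.
rewrite (bracketE oV vX vY Vp (smooth_near_conj sf)).
rewrite (bracketE oV (vfield_conj vX) (vfield_conj vY) Vp sf).
by rewrite rmorphB /conjf /conjv; congr (_^*%C - _^*%C);
  [congr (X p _)|congr (Y p _)]; apply/funext => q; rewrite conjcK.
Qed.

End ComplexCalculus.

(* The extension by zero makes equality on U coincide with Leibniz equality, so
   that the smooth functions on U form a ring. *)
Record locfun (R : realType) (m : nat) (M : manifold R m) (U : set M) (oU : open U) := Locfun {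
  lval :> M -> R[i];
  lsmooth : csmooth U lval;
  lout : forall q, ~ U q -> lval q = 0 }.

Section LocfunRing.
Variables (R : realType) (m : nat) (M : manifold R m) (U : set M) (oU : open U).
Local Notation A := (locfun oU).

HB.instance Definition _ := gen_eqMixin A.
HB.instance Definition _ := gen_choiceMixin A.

Lemma locfunP (a b : A) : (forall q, U q -> a q = b q) -> a = b.
Proof.
case: a b => [a sa na] [b sb nb] /= ab.
have e : a = b by apply/funext => q; have [/ab //|nq] := pselect (U q); rewrite na ?nb.
by rewrite e in sa na *; congr Locfun; exact: Prop_irrelevance.
Qed.

Definition res (f : M -> R[i]) (q : M) : R[i] := if `[< U q >] then f q else 0.

Lemma resE f q : U q -> res f q = f q.
Proof. by move=> Uq; rewrite /res asboolT. Qed.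

Lemma res_out f q : ~ U q -> res f q = 0.
Proof. by move=> Uq; rewrite /res asboolF. Qed.

Lemma res_smooth f : csmooth U f -> csmooth U (res f).
Proof. by apply: csmooth_ext => // q Uq; rewrite resE. Qed.

Definition restr f (sf : csmooth U f) : A := Locfun oU (res_smooth sf) (@res_out f).

Lemma restrE f (sf : csmooth U f) q : U q -> restr sf q = f q.
Proof. exact: resE. Qed.

Definition lf_add (a b : A) := restr (csmoothD oU (lsmooth a) (lsmooth b)).
Definition lf_mul (a b : A) := restr (csmoothM oU (lsmooth a) (lsmooth b)).
Definition lf_cst (z : R[i]) := restr (csmooth_cst U z).
Definition lf_opp (a : A) := lf_mul (lf_cst (-1)) a.

Local Ltac lf := move=> *; apply: locfunP => q Uq; rewrite /= ?resE // ?resE // /cst; ring.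

Fact lf_addA : associative lf_add. Proof. lf. Qed.
Fact lf_addC : commutative lf_add. Proof. lf. Qed.
Fact lf_add0 : left_id (lf_cst 0) lf_add. Proof. lf. Qed.
Fact lf_addN : left_inverse (lf_cst 0) lf_opp lf_add. Proof. lf. Qed.
Fact lf_mulA : associative lf_mul. Proof. lf. Qed.
Fact lf_mulC : commutative lf_mul. Proof. lf. Qed.
Fact lf_mul1 : left_id (lf_cst 1) lf_mul. Proof. lf. Qed.
Fact lf_mulD : left_distributive lf_mul lf_add. Proof. lf. Qed.

HB.instance Definition _ := GRing.isZmodule.Build A lf_addA lf_addC lf_add0 lf_addN.
HB.instance Definition _ := GRing.Zmodule_isComPzRing.Build A lf_mulA lf_mulC lf_mul1 lf_mulD.

Lemma lfD (a b : A) q : U q -> (a + b) q = a q + b q. Proof. exact: resE. Qed.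
Lemma lfM (a b : A) q : U q -> (a * b) q = a q * b q. Proof. exact: resE. Qed.
Lemma lf0 q : U q -> (0 : A) q = 0. Proof. exact: resE. Qed.
Lemma lf1 q : U q -> (1 : A) q = 1. Proof. exact: resE. Qed.
Lemma lfN (a : A) q : U q -> (- a) q = - a q.
Proof. by move=> Uq; rewrite /= !(resE _ Uq) mulN1r. Qed.
Lemma lfB (a b : A) q : U q -> (a - b) q = a q - b q.
Proof. by move=> Uq; rewrite lfD // lfN. Qed.
Lemma lf_sum (I : finType) (F : I -> A) q : U q -> (\sum_i F i) q = \sum_i F i q.
Proof. by move=> Uq; apply: (big_morph (fun a : A => a q) (fun a b => lfD a b Uq) (lf0 Uq)). Qed.
Lemma lf_nat k q : U q -> (k%:R : A) q = k%:R.
Proof. by move=> Uq; elim: k => [|k IH]; rewrite ?lf0 // -!natr1 lfD // IH lf1. Qed.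
Lemma lf_muln (a : A) k q : U q -> (a *+ k) q = a q *+ k.
Proof. by move=> Uq; rewrite -mulr_natr lfM // lf_nat // mulr_natr. Qed.

Lemma lf_near (a : A) p : U p -> smooth_near p a.
Proof. by move=> Up; apply: (smooth_nearI oU Up); exact: lsmooth. Qed.

Definition lconj (a : A) : A := restr (csmooth_conj oU (lsmooth a)).

Section Action.
Variables (X : cfield M) (vX : vfield U X).

Definition lder (a : A) : A := restr (vX.2 U a oU (fun=> id) (lsmooth a)).

Lemma lderE (a : A) (f : M -> R[i]) q : U q -> (forall x, U x -> f x = a x) -> lder a q = X q f.
Proof.
move=> Uq fa; rewrite [LHS](restrE _ Uq); apply: (tan_near (vX.1 _ Uq)).
by apply: (near_open oU Uq) => x /fa.
Qed.

Lemma derivation_lder : derivation lder.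
Proof.
split=> a b; apply: locfunP => q Uq; have tX := vX.1 _ Uq.
  rewrite lfD // !restrE // -(tanD tX); [|exact: lf_near..].
  by apply: (tan_near tX); apply: (near_open oU Uq) => x Ux; exact: lfD.
rewrite lfD // !lfM // !restrE // -(tanM tX); [|exact: lf_near..].
by apply: (tan_near tX); apply: (near_open oU Uq) => x Ux; exact: lfM.
Qed.

Lemma lder_cst z : lder (lf_cst z) = 0.
Proof.
apply: locfunP => q Uq; rewrite lf0 // [LHS](restrE _ Uq).
by apply: (tan_near_cst (vX.1 _ Uq)); apply: (near_open oU Uq) => x Ux; exact: resE.
Qed.

End Action.

Lemma lder_conj X (vX : vfield U X) (vXb : vfield U (conjf X)) a :
  lconj (lder vX a) = lder vXb (lconj a).
Proof.
apply: locfunP => q Uq; rewrite ![LHS](restrE _ Uq) (restrE _ Uq) [RHS](restrE _ Uq) /conjf /conjv.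
congr (_^*)%C; apply: (tan_near (vX.1 _ Uq)); apply: (near_open oU Uq) => x Ux /=.
by rewrite resE // conjcK.
Qed.

(* Multiply a germ by a bump function and use the Leibniz rule. *)
Lemma tangent_ext p D1 D2 : U p -> tangent p D1 -> tangent p D2 ->
  (forall a : A, D1 a = D2 a) -> D1 = D2.
Proof.
move=> Up t1 t2 H; apply/funext => f.
have [[V [oV Vp] sf]|nf] := pselect (smooth_near p f); last by rewrite (tan_out t1) ?(tan_out t2).
have [chi schi [chip [K [cK KV chi0]]]] := @smooth_bump _ _ M _ _ (openI oU oV) (conj Up Vp).
have sc W : csmooth W (fun q => (chi q)%:C%C) by apply: csmooth_real; exact: smooth_fun_sub schi.
(* The germ is smooth only on V; its product with chi is glued from V and the complement of K, where
   it is zero. *)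
have sg : csmooth U (fun q => (chi q)%:C%C * (if `[< K q >] then f q else 0)).
  apply: csmooth_local => q Uq; have [Vq|nVq] := pselect (V q).
    exists V; split=> //; apply: csmooth_ext oV _ (csmoothM oV (sc V) sf) => x Vx.
    by case: asboolP => // /chi0 ->; rewrite rmorph0 !mul0r.
  exists (~` K); split; [exact: closed_openC|by move=> /KV []|].
  apply: csmooth_ext (closed_openC cK) _ (csmooth_cst _ 0) => x /chi0 ->.
  by rewrite rmorph0 mul0r.
have key D : tangent p D -> D f = D (restr sg) - D (restr (sc U)) * f p.
  move=> t; have -> : D (restr (sc U)) = D (fun q => (chi q)%:C%C).
    by apply: (tan_near t); apply: (near_open oU Up) => x Ux; exact: resE.
  have -> : D (restr sg) = D (fun q => (chi q)%:C%C * f q).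
    apply: (tan_near t); apply: (near_open oU Up) => x Ux /=; rewrite resE //.
    by case: asboolP => // /chi0 ->; rewrite rmorph0 !mul0r.
  rewrite (tanM t); [|exact: (smooth_nearI oU Up)|by exists V].
  by rewrite chip rmorph1 mul1r; ring.
by rewrite (key _ t1) (key _ t2) !H.
Qed.

End LocfunRing.

(** * Commutation relations of a frame *)

Lemma conjc_Ni (R : rcfType) : ((- 'i%C : R[i])^*)%C = 'i%C.
Proof. by apply/eqP; rewrite eq_complex /= oppr0 opprK !eqxx. Qed.

Section LinearCombinations.
Variables (R : realType) (m : nat) (M : manifold R m).
Local Notation C := R[i].
Implicit Types (p : M) (U : set M).

Definition sumv (I : finType) (c : I -> C) (D : I -> cvec M) : cvec M :=
  fun f => \sum_i c i * D i f.

Lemma tangent_sumv (I : finType) p (c : I -> C) (D : I -> cvec M) :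
  (forall i, tangent p (D i)) -> tangent p (sumv c D).
Proof.
move=> tD; rewrite /sumv; elim: (index_enum I) => [|i r IH].
  rewrite (_ : (fun f => _) = @zerov _ _ M); first exact: tangent0.
  by apply/funext => f; rewrite big_nil.
rewrite (_ : (fun f => _) = addv (scalev (c i) (D i)) (fun f => \sum_(j <- r) c j * D j f)).
  exact: tangent_lin.
by apply/funext => f; rewrite big_cons.
Qed.

Section Form.
Variables (U : set M) (al : cform M) (p : M).
Hypotheses (fa : form1 U al) (Up : U p).

Lemma form_lin (z : C) D1 D2 : tangent p D1 -> tangent p D2 ->
  al p (addv (scalev z D1) D2) = z * al p D1 + al p D2.
Proof. by case: fa => H _; exact: H. Qed.

Lemma form0 : al p (@zerov _ _ M) = 0.
Proof.
have t0 := tangent0 p; have := form_lin 1 t0 t0.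
rewrite (_ : addv _ _ = @zerov _ _ M) ?mul1r; last first.
  by apply/funext => f; rewrite /addv /scalev /zerov mulr0 addr0.
by move=> e; apply: (addrI (al p (@zerov _ _ M))); rewrite -e addr0.
Qed.

Lemma form_sumv (I : finType) (c : I -> C) (D : I -> cvec M) :
  (forall i, tangent p (D i)) -> al p (sumv c D) = \sum_i c i * al p (D i).
Proof.
move=> tD; rewrite /sumv.
suff [] : tangent p (fun f => \sum_i c i * D i f) /\
  al p (fun f => \sum_i c i * D i f) = \sum_i c i * al p (D i) by [].
elim: (index_enum I) => [|i r [t IH]].
  rewrite (_ : (fun f => _) = @zerov _ _ M).
    by rewrite big_nil form0; split=> //; exact: tangent0.
  by apply/funext => f; rewrite big_nil.
rewrite (_ : (fun f => _) = addv (scalev (c i) (D i)) (fun f => \sum_(j <- r) c j * D j f)).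
  by rewrite form_lin // IH big_cons; split=> //; exact: tangent_lin.
by apply/funext => f; rewrite big_cons.
Qed.

End Form.

Lemma conj_sumv (I : finType) (c : I -> C) (D : I -> cvec M) :
  conjv (sumv c D) = sumv (fun i => (c i)^*%C) (fun i => conjv (D i)).
Proof. by apply/funext => f; rewrite /conjv /sumv rmorph_sum; apply: eq_bigr => i _; rewrite rmorphM. Qed.

Lemma conj_lin (z : C) (D1 D2 : cvec M) :
  conjv (addv (scalev z D1) D2) = addv (scalev z^*%C (conjv D1)) (conjv D2).
Proof. by apply/funext => f; rewrite /conjv /addv /scalev rmorphD rmorphM. Qed.

End LinearCombinations.

Section Frame.
Variables (R : realType) (n : nat) (M : pseudohermitian R n) (T : cfield M).
Hypotheses (hT : reeb T) (htor : vanishing_torsion T).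
Variables (U : set M) (oU : open U) (F : webster_frame T U).
Local Notation C := R[i].
Local Notation Z := (wZ F).
Local Notation th := (wth F).
Local Notation om := (wom F).
Local Notation Zb a := (conjf (Z a)).
Local Notation tht := (@theta R n M).

Lemma vZ a : vfield U (Z a).
Proof. by have [/(_ a) []] := wZ_frame F. Qed.

Lemma vZb a : vfield U (Zb a).
Proof. exact/vfield_conj/vZ. Qed.

Lemma vT : vfield U T.
Proof. by case: hT => v _ _ _; exact: vfield_sub v. Qed.

Lemma Z_T10 a q : U q -> T10_at tht (@cplxJ R n M) q (Z a q).
Proof. by have [/(_ a) [_ H] _] := wZ_frame F; exact: H. Qed.

Let tZ a q (Uq : U q) : tangent q (Z a q) := (vZ a).1 q Uq.
Let tZb a q (Uq : U q) : tangent q (Zb a q) := (vZb a).1 q Uq.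
Let tT q (Uq : U q) : tangent q (T q) := vT.1 q Uq.

Lemma form_theta : form1 setT tht.
Proof. by case: (theta_contact M). Qed.

Lemma theta_conj q D : tangent q D -> tht q (conjv D) = ((tht q D)^*)%C.
Proof. by case: (theta_contact M) => _ H _ _; exact: H. Qed.

Lemma theta_Z a q : U q -> tht q (Z a q) = 0.
Proof. by move=> /(Z_T10 a) []. Qed.

Lemma theta_Zb a q : U q -> tht q (Zb a q) = 0.
Proof. by move=> Uq; rewrite theta_conj ?theta_Z ?conjc0 //; exact: tZ. Qed.

Lemma theta_T q : tht q (T q) = 1.
Proof. by case: hT. Qed.

Lemma conj_T q : conjv (T q) = T q.
Proof. by case: hT. Qed.

Lemma form_th a : form1 U (th a).
Proof. by case: (wth_dual F). Qed.

Lemma th_Z a b q : U q -> th a q (Z b q) = (a == b)%:R.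
Proof. by case: (wth_dual F) => _ H _ _; exact: H. Qed.

Lemma th_Zb a b q : U q -> th a q (Zb b q) = 0.
Proof. by case: (wth_dual F) => _ _ H _; exact: H. Qed.

Lemma th_T a q : U q -> th a q (T q) = 0.
Proof. by case: (wth_dual F) => _ _ _ H; exact: H. Qed.

(** The factor [scalev 1] keeps every sum in the shape z D + E in which linearity of forms is
    stated. *)
Definition comb (w : C) (x y : 'I_n -> C) (q : M) : cvec M :=
  addv (scalev w (T q)) (addv (scalev 1 (sumv x (fun a => Z a q))) (sumv y (fun a => Zb a q))).

Lemma combE w x y q f :
  comb w x y q f = w * T q f + (\sum_a x a * Z a q f + \sum_a y a * Zb a q f).
Proof. by rewrite /comb /addv /scalev /sumv mul1r. Qed.

Section AtPoint.
Variables (q : M) (Uq : U q).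

Lemma tangent_comb w x y : tangent q (comb w x y q).
Proof.
apply: tangent_lin; first exact: tT.
by apply: tangent_lin; apply: tangent_sumv => a; [exact: tZ|exact: tZb].
Qed.

Lemma form_comb V al w x y : form1 V al -> V q ->
  al q (comb w x y q) =
  w * al q (T q) + (\sum_a x a * al q (Z a q) + \sum_a y a * al q (Zb a q)).
Proof.
move=> fa Vq.
have tS : tangent q (sumv x (fun a => Z a q)) by apply: tangent_sumv => a; exact: tZ.
have tSb : tangent q (sumv y (fun a => Zb a q)) by apply: tangent_sumv => a; exact: tZb.
rewrite (form_lin fa Vq) ?(form_lin fa Vq) ?mul1r //; [|exact: tT|exact: tangent_lin].
by rewrite !(form_sumv fa Vq) // => a; [exact: tZb|exact: tZ].
Qed.

Lemma theta_comb w x y : tht q (comb w x y q) = w.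
Proof.
rewrite (form_comb _ _ _ form_theta I) theta_T mulr1 !big1 ?addr0 // => a _.
  by rewrite theta_Zb // mulr0.
by rewrite theta_Z // mulr0.
Qed.

Lemma th_comb b w x y : th b q (comb w x y q) = x b.
Proof.
rewrite (form_comb _ _ _ (form_th b) Uq) th_T // mulr0 add0r [X in _ + X]big1 => [|a _].
  by rewrite addr0 -[RHS](sum_delta x); apply: eq_bigr => a _; rewrite th_Z // eq_sym.
by rewrite th_Zb // mulr0.
Qed.

Lemma conj_comb w x y : conjv (comb w x y q) =
  comb w^*%C (fun a => (y a)^*%C) (fun a => (x a)^*%C) q.
Proof.
rewrite /comb conj_lin conj_lin !conj_sumv conj_T; congr addv; apply/funext => f.
rewrite /addv /scalev conjc1 !mul1r addrC; congr (_ + _).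
by apply: eq_bigr => a _; rewrite /conjf conjvK.
Qed.

(* D - iJD is the (1,0)-part of 2D. *)
Lemma J_proj D : tangent q D -> tht q D = 0 ->
  T10_at tht (@cplxJ R n M) q (addv (scalev (- 'i%C) (cplxJ q D)) D).
Proof.
move=> tD D0; have [HJ linJ _] := cplxJ_structure M.
have [tJ J0 JJ _] := HJ _ _ tD D0; split; first exact: tangent_lin.
  by rewrite (form_lin form_theta) // J0 D0 mulr0 addr0.
rewrite linJ // JJ; apply/funext => f; rewrite /addv /scalev.
rewrite [RHS](_ : _ = - ('i%C ^+ 2) * cplxJ q D f + 'i%C * D f); last by ring.
rewrite sqr_i; ring.
Qed.

Lemma frame_coord D : T10_at tht (@cplxJ R n M) q D -> exists x, D = sumv x (fun a => Z a q).
Proof. by move=> tD; have [_ /(_ q D Uq tD) [x [-> _]]] := wZ_frame F; exists x. Qed.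

(** After subtracting theta(D) T, the horizontal rest H splits by J. Its (0,1)-part is the conjugate
    of the (1,0)-part of conj H, so the frame of T_{1,0} expands both. Existence suffices, as the
    coframe recovers the coefficients. *)
Lemma frame_decomp D : tangent q D ->
  D = comb (tht q D) (fun a => th a q D) (fun a => ((th a q (conjv D))^*)%C) q.
Proof.
move=> tD.
suff [w [x [y ->]]] : exists w x y, D = comb w x y q.
  rewrite theta_comb conj_comb; congr comb; apply/funext => a; rewrite th_comb //.
  by rewrite conjcK.
pose H := addv (scalev (- tht q D) (T q)) D.
have tH : tangent q H by apply: tangent_lin => //; exact: tT.
have H0 : tht q H = 0 by rewrite (form_lin form_theta) ?theta_T ?mulr1 ?addNr //; exact: tT.
have tcH := tangent_conj tH.
have cH0 : tht q (conjv H) = 0 by rewrite theta_conj // H0 conjc0.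
have [HJ _ _] := cplxJ_structure M; have [_ _ _ cJ] := HJ _ _ tH H0.
have [x ex] := frame_coord (J_proj tH H0).
have [y ey] := frame_coord (J_proj tcH cH0).
move: ey => /(congr1 (@conjv _ _ M)); rewrite conj_lin conj_sumv cJ !conjvK => ey.
exists (tht q D), (fun a => 2^-1 * x a), (fun a => 2^-1 * (y a)^*%C).
apply/funext => f; rewrite combE.
have ex1 : \sum_a 2^-1 * x a * Z a q f = 2^-1 * (- 'i%C * cplxJ q H f + H f).
  have := congr1 (fun D => D f) ex; rewrite /addv /scalev /sumv => ->.
  by rewrite big_distrr; apply: eq_bigr => a _; rewrite /= mulrA.
have ey1 : \sum_a 2^-1 * (y a)^*%C * Zb a q f = 2^-1 * ('i%C * cplxJ q H f + H f).
  have := congr1 (fun D => D f) ey; rewrite /addv /scalev /sumv conjc_Ni => ->.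
  by rewrite big_distrr; apply: eq_bigr => a _; rewrite /= mulrA.
by rewrite ex1 ey1 /H /addv /scalev; field.
Qed.

End AtPoint.

Lemma near_U q (P : M -> Prop) : U q -> (forall x, U x -> P x) -> \forall x \near q, P x.
Proof. exact: near_open. Qed.

(** In Cartan's formula the two derivative terms vanish when the form is constant on both fields. *)
Lemma dform_bracket (al : cform M) X Y (x y : C) q : U q -> vfield U X -> vfield U Y ->
  (forall r, U r -> al r (X r) = x) -> (forall r, U r -> al r (Y r) = y) ->
  al q (bracket X Y q) = - dform al X Y q.
Proof.
move=> Uq vX vY ax ay; rewrite /dform.
rewrite (tan_near_cst (vX.1 q Uq) (near_U Uq ay)) (tan_near_cst (vY.1 q Uq) (near_U Uq ax)).
by rewrite subrr sub0r opprK.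
Qed.

(** Without torsion the structure equation involves only the connection forms, so it determines the
    (1,0)-components of brackets of fields with constant components. *)
Lemma th_bracket b X Y (x y : 'I_n -> C) q : U q -> vfield U X -> vfield U Y ->
  (forall c r, U r -> th c r (X r) = x c) -> (forall c r, U r -> th c r (Y r) = y c) ->
  th b q (bracket X Y q) = - \sum_a (x a * om a b q (Y q) - y a * om a b q (X q)).
Proof.
move=> Uq vX vY ax ay; rewrite (dform_bracket Uq vX vY (ax b) (ay b)); congr (- _).
rewrite (structure_eq F b oU (fun=> id) vX vY Uq).
have tau0 D : conj_form (tau_low th (wA F) b) q D = 0.
  rewrite /conj_form /tau_low big1 ?conjc0 // => c _.
  by rewrite (htor oU) // mul0r.
rewrite [X in _ + X = _](_ : _ = 0) ?addr0; last by rewrite /wedge !tau0; ring.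
by apply: eq_bigr => a _; rewrite /wedge !ax // !ay.
Qed.

Lemma om_conj a b q D : U q -> tangent q D -> ((om a b q D)^*)%C = - om b a q (conjv D).
Proof.
move=> Uq tD; have /eqP := skew_eq F b a Uq (tangent_conj tD).
by rewrite /conj_form conjvK addrC addr_eq0 => /eqP.
Qed.

Lemma sum_deltal (G : 'I_n -> C) a : \sum_d (d == a)%:R * G d = G a.
Proof. by rewrite -[RHS](sum_delta G); apply: eq_bigr => d _; rewrite mulrC. Qed.

(** * Lie brackets of the frame fields *)

Section Brackets.
Variables (q : M) (Uq : U q).
Let P a b c := om a b q (Z c q).
Let Q a b c := om a b q (Zb c q).
Let N a b := om a b q (T q).

Lemma conjP a b c : ((P a b c)^*)%C = - Q b a c. Proof. exact: om_conj (tZ _ Uq). Qed.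
Lemma conjQ a b c : ((Q a b c)^*)%C = - P b a c.
Proof. by rewrite /Q om_conj /conjf ?conjvK //; exact: (tZb c Uq). Qed.
Lemma conjN a b : ((N a b)^*)%C = - N b a.
Proof. by rewrite /N om_conj ?conj_T //; exact: tT. Qed.

(** Orthonormality for the Levi form gives the T-component, the structure equation the
    (1,0)-components, and the same equation for the conjugate bracket the (0,1)-components. *)
Lemma bracket_ZZb a c : bracket (Z a) (Zb c) q =
  comb (- 'i%C * (a == c)%:R) (fun b => - Q a b c) (fun b => - P b c a) q.
Proof.
rewrite [LHS](frame_decomp Uq (tangent_bracket oU (vZ a) (vZb c) Uq)); congr comb.
- have := wZ_orthonormal F a c Uq; rewrite /levi /levi_form => e.
  rewrite (dform_bracket Uq (vZ a) (vZb c) (theta_Z a) (theta_Zb c)) -e.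
  rewrite mulrA mulNr mulrN opprK -expr2 sqr_i; ring.
- apply/funext => b.
  rewrite (th_bracket b Uq (vZ a) (vZb c) (x := fun d => (d == a)%:R) (y := fun=> 0)).
  + under eq_bigr do rewrite mul0r subr0.
    by rewrite sum_deltal.
  + by move=> d r Ur; rewrite th_Z.
  + by move=> d r Ur; rewrite th_Zb.
- apply/funext => b; rewrite (conj_bracket oU (vZ a) (vZb c) Uq).
  have -> : conjf (Zb c) = Z c by apply/funext => r; rewrite /conjf conjvK.
  rewrite (th_bracket b Uq (vZb a) (vZ c) (x := fun=> 0) (y := fun d => (d == c)%:R)).
  + under eq_bigr do rewrite mul0r sub0r.
    by rewrite sumrN opprK sum_deltal -/(Q c b a) conjQ.
  + by move=> d r Ur; rewrite th_Zb.
  + by move=> d r Ur; rewrite th_Z.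
Qed.

(** The T-component vanishes by integrability of the CR structure. *)
Lemma bracket_ZZ a c : bracket (Z a) (Z c) q =
  comb 0 (fun b => P c b a - P a b c) (fun=> 0) q.
Proof.
have [fa0 _] := wZ_frame F.
rewrite [LHS](frame_decomp Uq (tangent_bracket oU (vZ a) (vZ c) Uq)); congr comb.
- by have [_ /(_ q Uq) []] := cplxJ_integrable oU (fa0 a) (fa0 c).
- apply/funext => b.
  rewrite (th_bracket b Uq (vZ a) (vZ c) (x := fun d => (d == a)%:R) (y := fun d => (d == c)%:R)).
  + by rewrite sumrB !sum_deltal opprB.
  + by move=> d r Ur; rewrite th_Z.
  + by move=> d r Ur; rewrite th_Z.
- apply/funext => b; rewrite (conj_bracket oU (vZ a) (vZ c) Uq).
  rewrite (th_bracket b Uq (vZb a) (vZb c) (x := fun=> 0) (y := fun=> 0)).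
  + by rewrite big1 ?oppr0 ?conjc0 // => d _; rewrite !mul0r subrr.
  + by move=> d r Ur; rewrite th_Zb.
  + by move=> d r Ur; rewrite th_Zb.
Qed.

Lemma bracket_ZbZb a c : bracket (Zb a) (Zb c) q =
  comb 0 (fun=> 0) (fun b => Q b a c - Q b c a) q.
Proof.
rewrite -(conj_bracket oU (vZ a) (vZ c) Uq) bracket_ZZ conj_comb conjc0; congr comb.
by apply/funext => b; rewrite rmorphB /= !conjP; ring.
Qed.

(** The T-component vanishes by the Reeb condition, and the (0,1)-components because there is no
    torsion. *)
Lemma bracket_TZ a : bracket T (Z a) q = comb 0 (fun b => N a b) (fun=> 0) q.
Proof.
rewrite [LHS](frame_decomp Uq (tangent_bracket oU vT (vZ a) Uq)); congr comb.
- case: hT => _ _ _ hd.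
  rewrite (dform_bracket Uq vT (vZ a) (fun r _ => theta_T r) (theta_Z a)).
  by rewrite (hd U _ oU (vZ a) q Uq) oppr0.
- apply/funext => b.
  rewrite (th_bracket b Uq vT (vZ a) (x := fun=> 0) (y := fun d => (d == a)%:R)).
  + under eq_bigr do rewrite mul0r sub0r.
    by rewrite sumrN opprK sum_deltal.
  + by move=> d r Ur; rewrite th_T.
  + by move=> d r Ur; rewrite th_Z.
- apply/funext => b; rewrite (conj_bracket oU vT (vZ a) Uq).
  have -> : conjf T = T by apply/funext => r; rewrite /conjf conj_T.
  rewrite (th_bracket b Uq vT (vZb a) (x := fun=> 0) (y := fun=> 0)).
  + by rewrite big1 ?oppr0 ?conjc0 // => d _; rewrite !mul0r subrr.
  + by move=> d r Ur; rewrite th_T.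
  + by move=> d r Ur; rewrite th_Zb.
Qed.

Lemma bracket_TZb a : bracket T (Zb a) q = comb 0 (fun=> 0) (fun b => - N b a) q.
Proof.
have eT : conjf T = T by apply/funext => r; rewrite /conjf conj_T.
rewrite -{1}eT -(conj_bracket oU vT (vZ a) Uq) bracket_TZ conj_comb conjc0; congr comb.
by apply/funext => b; rewrite conjN.
Qed.

End Brackets.

Local Notation A := (locfun oU).

Lemma om_smooth a b X : vfield U X -> csmooth U (fun q => om a b q (X q)).
Proof. by move=> vX; case: (wom_form F a b) => _; apply. Qed.

Lemma lder_bracket X Y (vX : vfield U X) (vY : vfield U Y) (f : A) q : U q ->
  (lder vX (lder vY f) - lder vY (lder vX f)) q = bracket X Y q f.
Proof.
move=> Uq; rewrite lfB // (bracketE oU vX vY Uq (lf_near f Uq)).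
congr (_ - _).
  by apply: lderE => // x Ux; symmetry; apply: lderE.
by apply: lderE => // x Ux; symmetry; apply: lderE.
Qed.

Definition aZ a := lder (oU := oU) (vZ a).
Definition aZb a := lder (oU := oU) (vZb a).
Definition aT := lder (oU := oU) vT.
Definition aP a b c : A := restr oU (om_smooth a b (vZ c)).
Definition aQ a b c : A := restr oU (om_smooth a b (vZb c)).
Definition aN a b : A := restr oU (om_smooth a b vT).
Definition ai : A := lf_cst oU 'i%C.

Lemma comb_lf w (x y : 'I_n -> A) (f : A) q : U q ->
  comb w (fun a => x a q) (fun a => y a q) q f =
  w * aT f q + ((\sum_a x a * aZ a f) q + (\sum_a y a * aZb a f) q).
Proof.
move=> Uq; rewrite combE !lf_sum //; congr (_ * _ + (_ + _)).
- by symmetry; apply: lderE.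
- by apply: eq_bigr => a _; rewrite lfM //; congr (_ * _); symmetry; apply: lderE.
- by apply: eq_bigr => a _; rewrite lfM //; congr (_ * _); symmetry; apply: lderE.
Qed.

(** At each point the combination is a tangent vector killing every function smooth on U, hence zero
    by [tangent_ext]; the coframe then returns the coefficients. *)
Lemma aF_indep (x y : 'I_n -> A) :
  (forall f, \sum_c x c * aZ c f + \sum_c y c * aZb c f = 0) ->
  (forall c, x c = 0) /\ (forall c, y c = 0).
Proof.
move=> H.
have e q (Uq : U q) : comb 0 (fun a => x a q) (fun a => y a q) q = @zerov _ _ M.
  apply: (tangent_ext (oU := oU) Uq); [exact: tangent_comb|exact: tangent0|] => f.
  by rewrite comb_lf // -lfD // H lf0 // mul0r addr0.
split=> c; apply: locfunP => q Uq; rewrite lf0 //.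
  by rewrite -(th_comb Uq c 0 (fun a => x a q) (fun a => y a q)) e // (form0 (form_th c) Uq).
have := congr1 (fun D => th c q (conjv D)) (e q Uq); rewrite conj_comb th_comb //.
rewrite (_ : conjv _ = @zerov _ _ M) ?(form0 (form_th c) Uq); last first.
  by apply/funext => f; rewrite /conjv /zerov conjc0.
by move/(congr1 (fun z : C => (z^*)%C)); rewrite conjcK conjc0.
Qed.

Lemma lf_comb_eq (f w : A) (x y : 'I_n -> A) (h : A) :
  (forall q, U q -> f q = comb (w q) (fun a => x a q) (fun a => y a q) q h) ->
  f = w * aT h + (\sum_a x a * aZ a h + \sum_a y a * aZb a h).
Proof. by move=> H; apply: locfunP => q Uq; rewrite H // comb_lf // lfD // lfM // lfD. Qed.

Lemma aF_ZZb a c f : aZ a (aZb c f) - aZb c (aZ a f) =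
  - \sum_b aQ a b c * aZ b f - \sum_b aP b c a * aZb b f - ai * (a == c)%:R * aT f.
Proof.
rewrite [LHS](@lf_comb_eq _ (- ai * (a == c)%:R) (fun b => - aQ a b c) (fun b => - aP b c a) f).
  by rewrite !sum_mulNl; ring.
move=> q Uq; rewrite lder_bracket // bracket_ZZb //; congr (comb _ _ _ q f).
- by rewrite lfM // lfN // lf_nat // [ai q]restrE.
- by apply/funext => b; rewrite lfN // restrE.
- by apply/funext => b; rewrite lfN // restrE.
Qed.

Lemma aF_ZZ a c f : aZ a (aZ c f) - aZ c (aZ a f) = \sum_b (aP c b a - aP a b c) * aZ b f.
Proof.
rewrite [LHS](@lf_comb_eq _ 0 (fun b => aP c b a - aP a b c) (fun=> 0) f).
  by rewrite mul0r add0r [X in _ + X]big1 ?addr0 // => b _; rewrite mul0r.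
move=> q Uq; rewrite lder_bracket // bracket_ZZ //; congr (comb _ _ _ q f).
- by rewrite lf0.
- by apply/funext => b; rewrite lfB // !restrE.
- by apply/funext => b; rewrite lf0.
Qed.

Lemma aF_ZbZb a c f : aZb a (aZb c f) - aZb c (aZb a f) = \sum_b (aQ b a c - aQ b c a) * aZb b f.
Proof.
rewrite [LHS](@lf_comb_eq _ 0 (fun=> 0) (fun b => aQ b a c - aQ b c a) f).
  by rewrite mul0r add0r [X in X + _]big1 ?add0r // => b _; rewrite mul0r.
move=> q Uq; rewrite lder_bracket // bracket_ZbZb //; congr (comb _ _ _ q f).
- by rewrite lf0.
- by apply/funext => b; rewrite lf0.
- by apply/funext => b; rewrite lfB // !restrE.
Qed.

Lemma aF_TZ a f : aT (aZ a f) - aZ a (aT f) = \sum_b aN a b * aZ b f.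
Proof.
rewrite [LHS](@lf_comb_eq _ 0 (fun b => aN a b) (fun=> 0) f).
  by rewrite mul0r add0r [X in _ + X]big1 ?addr0 // => b _; rewrite mul0r.
move=> q Uq; rewrite lder_bracket // bracket_TZ //; congr (comb _ _ _ q f).
- by rewrite lf0.
- by apply/funext => b; rewrite restrE.
- by apply/funext => b; rewrite lf0.
Qed.

Lemma aF_TZb a f : aT (aZb a f) - aZb a (aT f) = - \sum_b aN b a * aZb b f.
Proof.
rewrite [LHS](@lf_comb_eq _ 0 (fun=> 0) (fun b => - aN b a) f).
  by rewrite sum_mulNl mul0r add0r [X in X + _]big1 ?add0r // => b _; rewrite mul0r.
move=> q Uq; rewrite lder_bracket // bracket_TZb //; congr (comb _ _ _ q f).
- by rewrite lf0.
- by apply/funext => b; rewrite lf0.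
- by apply/funext => b; rewrite lfN // restrE.
Qed.

Definition webster_algebra : frame_algebra A n := FrameAlgebra
  (fun a => derivation_lder oU (vZ a)) (fun a => derivation_lder oU (vZb a)) (derivation_lder oU vT)
  (fun a => lder_cst oU (vZ a) 'i%C) (fun a => lder_cst oU (vZb a) 'i%C) (lder_cst oU vT 'i%C)
  aF_ZZb aF_ZZ aF_ZbZb aF_TZ aF_TZb aF_indep.

End Frame.

(** * The curvature-dimension inequality *)

Section Inequality.
Variables (R : rcfType) (n : nat).
Local Notation C := R[i].

Lemma sum_mulcJ_ge0 (I : finType) (x : I -> C) : 0 <= \sum_i x i * (x i)^*%C.
Proof. by apply: sumr_ge0 => i _; exact: mulcJ_ge0. Qed.

(* Cauchy-Schwarz, the imaginary part of each x_a being fixed to t/2. *)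
Lemma diag_ineq (x : 'I_n -> C) (t : C) : (0 < n)%N ->
  (forall a, x a - (x a)^*%C = 'i%C * t) -> t^*%C = t ->
  (2 * n%:R)^-1 * (2 * \sum_a (x a + (x a)^*%C)) ^+ 2 + 2 * n%:R * t ^+ 2 <=
  8 * \sum_a x a * (x a)^*%C.
Proof.
move=> n0 xt tr; have nN0 : (n%:R : C) != 0 by rewrite pnatr_eq0 -lt0n.
pose r a := x a + (x a)^*%C; set S := \sum_a _.
have rr a : (r a)^*%C = r a by rewrite /r rmorphD /= conjcK addrC.
have Sr : S^*%C = S by rewrite /S rmorph_sum; apply: eq_bigr => a _; exact: rr.
(* Cauchy-Schwarz as nonnegativity of the sum of squared deviations of [r a], twice the real part of
   [x a], from their mean S/n. *)
have := sum_mulcJ_ge0 (fun a => r a - n%:R^-1 * S).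
rewrite -(ler_pM2l (ltr0n C 2)) mulr0 => H; rewrite -subr_ge0.
suff <- : 2 * (\sum_a (r a - n%:R^-1 * S) * (r a - n%:R^-1 * S)^*%C) =
    8 * \sum_a x a * (x a)^*%C -
    ((2 * n%:R)^-1 * (2 * S) ^+ 2 + 2 * n%:R * t ^+ 2) by [].
have -> : \sum_a (r a - n%:R^-1 * S) * (r a - n%:R^-1 * S)^*%C = \sum_a r a ^+ 2 - n%:R^-1 * S ^+ 2.
  have e a : (r a - n%:R^-1 * S) * (r a - n%:R^-1 * S)^*%C =
      r a ^+ 2 - 2 * n%:R^-1 * S * r a + n%:R^-2 * S ^+ 2.
    by rewrite rmorphB rmorphM /= rr Sr conjc_inv conjc_nat; field; exact: nN0.
  under eq_bigr do rewrite e.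
  rewrite big_split sumrB /= -big_distrr -/S sumr_const card_ord -mulr_natr /=; field.
  exact: nN0.
have -> : \sum_a x a * (x a)^*%C = 4^-1 * (\sum_a r a ^+ 2 + n%:R * t ^+ 2).
  have e a : x a * (x a)^*%C = 4^-1 * (r a ^+ 2 + t ^+ 2).
    have -> : t ^+ 2 = - ('i%C * t) ^+ 2 by rewrite exprMn sqr_i; ring.
    by rewrite -(xt a) /r; field.
  under eq_bigr do rewrite e.
  by rewrite -big_distrr big_split sumr_const card_ord -[_ *+ n]mulr_natl.
field; exact: nN0.
Qed.

(* The mixed term is absorbed by the square of nu be - 2i al. *)
Lemma cd_ineq (al be : 'I_n -> C) (h ka : 'I_n -> 'I_n -> C) (t ric : C) (k nu : R) :
  (0 < n)%N -> 0 < nu -> t^*%C = t -> (forall a, ka a a - (ka a a)^*%C = 'i%C * t) ->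
  - k%:C%C * (\sum_a al a * (al a)^*%C) <= 2 * ric ->
  ((2 * n%:R)^-1)%:C%C * (2 * \sum_a (ka a a + (ka a a)^*%C)) ^+ 2
    + (- k - 4 / nu)%:C%C * (4 * \sum_a al a * (al a)^*%C)
    + (2 * n%:R)%:C%C * t ^+ 2 <=
  4 * (2 * ric + 2 * 'i%C * (\sum_a (al a)^*%C * be a - \sum_a al a * (be a)^*%C)
       + 2 * \sum_b (\sum_a h b a * (h b a)^*%C + \sum_a ka b a * (ka b a)^*%C))
  + nu%:C%C * (4 * \sum_a be a * (be a)^*%C).
Proof.
move=> n0 nu0 tr kt Hric.
set v := nu%:C%C; set kk := k%:C%C.
have cjM (x y : C) : (x * y)^*%C = x^*%C * y^*%C by exact: rmorphM.
have cjB (x y : C) : (x - y)^*%C = x^*%C - y^*%C by exact: rmorphB.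
have vr : v^*%C = v by exact: conjc_real.
have ci : ('i%C : C)^*%C = - 'i%C by apply/eqP; rewrite eq_complex /= oppr0 !eqxx.
have v0 : v != 0 by rewrite (inj_eq (@complexI R)) gt_eqF.
have vpos : 0 <= v^-1 by rewrite invr_ge0 ler0c ltW.
have -> : ((2 * n%:R)^-1)%:C%C = (2 * n%:R)^-1 :> C by rewrite fmorphV rmorphM !rmorph_nat.
have -> : (- k - 4 / nu)%:C%C = - kk - 4 / v by rewrite rmorphB rmorphN fmorph_div rmorph_nat.
have -> : (2 * n%:R)%:C%C = 2 * n%:R :> C by rewrite rmorphM !rmorph_nat.
have D1 := diag_ineq n0 kt tr.
set S := \sum_a (ka a a + _) in D1 *; set N := \sum_a al a * (al a)^*%C in Hric *.
have D2 : \sum_a ka a a * (ka a a)^*%C <= \sum_b \sum_a ka b a * (ka b a)^*%C.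
  apply: ler_sum => b _; rewrite [leRHS](bigD1 b) //= lerDl.
  by apply: sumr_ge0 => a _; exact: mulcJ_ge0.
have D3 : 0 <= \sum_b \sum_a h b a * (h b a)^*%C.
  by apply: sumr_ge0 => b _; exact: sum_mulcJ_ge0.
(* The weight 4/nu makes the [be] part equal to nu Gamma(f_0,f_0). The [al] part is then (16/nu) N =
   (4/nu) Gamma(f,f), which is the origin of kappa = 4. *)
have D4 : 0 <= 4 * v^-1 * \sum_a (v * be a - 2 * 'i%C * al a) * (v * be a - 2 * 'i%C * al a)^*%C.
  by apply: mulr_ge0; [apply: mulr_ge0; rewrite ?ler0n|exact: sum_mulcJ_ge0].
have E4 : 4 * v^-1 * \sum_a (v * be a - 2 * 'i%C * al a) * (v * be a - 2 * 'i%C * al a)^*%C =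
   4 * v * (\sum_a be a * (be a)^*%C) + 16 / v * N
   + 8 * 'i%C * (\sum_a (al a)^*%C * be a - \sum_a al a * (be a)^*%C).
  rewrite /N !(big_distrr, mulrBr) /= -!(sumrB, big_split) /=; apply: eq_bigr => a _.
  have -> : (v * be a - 2 * 'i%C * al a)^*%C = v * (be a)^*%C + 2 * 'i%C * (al a)^*%C.
    rewrite cjB !cjM vr ci conjc_nat; ring.
  have -> x y z w : (v * x - 2 * 'i%C * y) * (v * z + 2 * 'i%C * w) =
    v ^+ 2 * x * z - 4 * 'i%C ^+ 2 * y * w + 2 * v * 'i%C * (x * w - y * z) :> C by ring.
  rewrite sqr_i; field; exact: v0.
rewrite E4 in D4.
rewrite big_split /=.
set K := \sum_b \sum_a ka b a * _ in D2 *; set H := \sum_b \sum_a h b a * _ in D3 *.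
set K0 := \sum_a ka a a * _ in D1 D2; set cr := \sum_a (al a)^*%C * be a - _ in D4 *.
set B := \sum_a be a * _ in D4 *.
have P1 : 0 <= 8 * K0 - ((2 * n%:R)^-1 * (2 * S) ^+ 2 + 2 * n%:R * t ^+ 2) by rewrite subr_ge0.
have P2 : 0 <= 8 * (K - K0) by rewrite mulr_ge0 ?ler0n ?subr_ge0.
have P3 : 0 <= 8 * H by rewrite mulr_ge0 ?ler0n.
have P4 : 0 <= 4 * (2 * ric - (- kk * N)) by rewrite mulr_ge0 ?ler0n ?subr_ge0.
(* The right side minus the left side is exactly this sum: Cauchy-Schwarz defect, off-diagonal mixed
   Hessian, (2,0)-Hessian, Ricci defect and completed square. *)
have := addr_ge0 (addr_ge0 (addr_ge0 P1 P2) (addr_ge0 P3 P4)) D4.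
rewrite -subr_ge0 => P; rewrite -subr_ge0.
apply: le_trans P _; rewrite le_eqVlt; apply/orP; left; apply/eqP; ring.
Qed.

End Inequality.

(** * Values of the abstract operators at the points of U *)

Section Translation.
Variables (R : realType) (n : nat) (M : pseudohermitian R n) (T : cfield M).
Hypotheses (hT : reeb T) (htor : vanishing_torsion T).
Variables (U : set M) (oU : open U) (F : webster_frame T U).
Local Notation C := R[i].
Local Notation Z := (wZ F).
Local Notation om := (wom F).
Local Notation Zb a := (conjf (Z a)).
Local Notation A := (locfun oU).
Local Notation FA := (webster_algebra hT htor oU F).

Lemma fP_val a b c q : U q -> fP FA a b c q = om a b q (Z c q).
Proof. exact: restrE. Qed.

Lemma fQ_val a b c q : U q -> fQ FA a b c q = om a b q (Zb c q).
Proof. exact: restrE. Qed.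

Lemma fN_val a b q : U q -> fN FA a b q = om a b q (T q).
Proof. exact: restrE. Qed.

Lemma fi_val q : U q -> fi FA q = 'i%C.
Proof. exact: restrE. Qed.

Section Values.
Variables (g : M -> C) (b : A).
Hypothesis gb : forall x, U x -> g x = b x.

Lemma Z_val a q : U q -> Z a q g = fZ FA a b q.
Proof. by move=> Uq; symmetry; exact: lderE. Qed.

Lemma Zb_val a q : U q -> Zb a q g = fZb FA a b q.
Proof. by move=> Uq; symmetry; exact: lderE. Qed.

Lemma T_val q : U q -> T q g = fT FA b q.
Proof. by move=> Uq; symmetry; exact: lderE. Qed.

End Values.

Lemma opL_val (g : M -> C) (b : A) q : (forall x, U x -> g x = b x) -> U q ->
  opL F g q = (sublap FA b *+ 2) q.
Proof.
move=> gb Uq; rewrite lf_muln // /opL /sublaplacian /sublap lf_sum // mulr_natl.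
congr (_ *+ 2); apply: eq_bigr => a _; rewrite lfD //; congr (_ + _).
  rewrite /hess_ab' /nZb /cov lfB // lf_sum //; congr (_ - _).
    by apply: Zb_val => // x Ux; exact: Z_val.
  by apply: eq_bigr => c _; rewrite lfM // (Z_val gb) // fQ_val.
rewrite /hess_a'b nZ01E lfD // lf_sum //; congr (_ + _).
  by apply: Z_val => // x Ux; exact: Zb_val.
rewrite -sumrN; apply: eq_bigr => c _; rewrite lfM // (Zb_val gb) // -mulNr; congr (_ * _).
by rewrite /conj_form (om_conj F) ?opprK ?conjvK ?fP_val //; exact: (vZb F a).1.
Qed.

Lemma Gamma_val (f g : M -> C) (a b : A) q : (forall x, U x -> f x = a x) ->
  (forall x, U x -> g x = b x) -> U q -> Gamma F f g q = carre FA a b q.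
Proof.
move=> fa gb Uq; rewrite /Gamma big_split_ord /= -big_split /carre lf_sum //.
apply: eq_bigr => c _; rewrite /real_frame (unsplitK (inl c)) (unsplitK (inr c)).
rewrite /addv /scalev !(Z_val fa, Z_val gb, Zb_val fa, Zb_val gb) //.
rewrite lf_muln // lfD // !lfM //.
rewrite -[LHS]/(_ + _). have -> x y z w : (x + y) * (z + w) + 'i%C * (x + -1 * y) * ('i%C * (z + -1 * w)) =
   (x + y) * (z + w) + 'i%C ^+ 2 * (x - y) * (z - w) :> C by ring.
rewrite sqr_i; ring.
Qed.

Lemma curvature_val b a r s q : U q -> curvature F b a r s q = curv FA b a r s q.
Proof.
move=> Uq; rewrite /curvature /curvature_form /dform /curv /om_br.
rewrite !lfB // lf_sum //; congr (_ - _ - _ - _).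
- by apply: Z_val => // x Ux; rewrite fQ_val.
- by apply: Zb_val => // x Ux; rewrite fP_val.
- rewrite (bracket_ZZb hT htor oU F Uq) (form_comb hT F Uq _ _ _ (wom_form F b a) Uq).
  have -> : (- \sum_d fQ FA r d s * fP FA b a d) q = \sum_d - om r d q (Zb s q) * om b a q (Z d q).
    rewrite lfN // lf_sum // -sumrN; apply: eq_bigr => d _.
    by rewrite lfM // fQ_val // fP_val // mulNr.
  have -> : \sum_d (fP FA d s r * fQ FA b a d) q = - \sum_d - om d s q (Z r q) * om b a q (Zb d q).
    rewrite -sumrN; apply: eq_bigr => d _.
    by rewrite lfM // fQ_val // fP_val // mulNr opprK.
  rewrite !lfM // lf_nat // fi_val // fN_val //; ring.
- rewrite lf_sum //; apply: eq_bigr => c _; rewrite /wedge lfB // !lfM //.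
  by rewrite !fQ_val // !fP_val.
Qed.

Lemma ricci_val a b q : U q -> ricci_tensor F a b q = ric FA a b q.
Proof.
by move=> Uq; rewrite /ricci_tensor /ric lf_sum //; apply: eq_bigr => c _; rewrite curvature_val.
Qed.

Lemma J0 p : cplxJ p (@zerov _ _ M) = @zerov _ _ M.
Proof.
have [_ linJ _] := cplxJ_structure M.
have t0 := tangent0 p; have th0 := form0 (form_theta M) I (p := p).
have := linJ p 1 _ _ t0 th0 t0 th0.
rewrite (_ : addv (scalev 1 (@zerov _ _ M)) _ = @zerov _ _ M) => [e|]; last first.
  by apply/funext => f; rewrite /addv /scalev /zerov mulr0 addr0.
apply/funext => f; have := congr1 (fun D => D f) e; rewrite /addv /scalev mul1r => e2.
by apply: (addrI (cplxJ p (@zerov _ _ M) f)); rewrite -e2 /zerov addr0.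
Qed.

Section Cutoff.
Variables (p : M) (Up : U p) (c : 'I_n -> C) (k : R) (hRic : ricci_lower_bound T k).

(* The Ricci hypothesis concerns global sections, hence the cutoff of
   sum_a c_a Z_a. *)
Lemma ricci_bound :
  - k%:C%C * (\sum_a c a * (c a)^*%C) <=
  2 * \sum_a \sum_b ricci_tensor F a b p * c a * (c b)^*%C.
Proof.
have [chi schi [chip [K [cK KU chi0]]]] := @smooth_bump _ _ M _ _ oU Up.
(* As chi(p) = 1, this global section has the prescribed value at p, and it vanishes outside U. *)
pose W : cfield M := fun q => scalev (chi q)%:C%C (sumv c (fun a => Z a q)).
have W0 q : chi q = 0 -> W q = @zerov _ _ M.
  by move=> e; apply/funext => f; rewrite /W /scalev e rmorph0 mul0r.
have tS q : U q -> tangent q (sumv c (fun a => Z a q)).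
  by move=> Uq; apply: tangent_sumv => a; exact: (vZ F a).1.
have addv0 (D : cvec M) : addv D (@zerov _ _ M) = D.
  by apply/funext => f; rewrite /addv /zerov addr0.
have U0 q : ~ U q -> W q = @zerov _ _ M by move=> nU; apply/W0/chi0 => /KU.
have tW q : tangent q (W q).
  have [Uq|/U0 ->] := pselect (U q); last exact: tangent0.
  by rewrite -[W q]addv0; apply: tangent_lin; [exact: tS|exact: tangent0].
have thW q : theta q (W q) = 0.
  have [Uq|/U0 ->] := pselect (U q); last exact: (form0 (form_theta M)).
  rewrite -[W q]addv0 (form_lin (form_theta M)) //; [|exact: tS|exact: tangent0].
  rewrite (form0 (form_theta M)) // addr0 (form_sumv (form_theta M)) // => [|a].
    by rewrite big1 ?mulr0 // => a _; rewrite theta_Z ?mulr0.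
  exact: (vZ F a).1.
have vW : vfield setT W.
  split=> [q _|V f oV _ sf]; first exact: tW.
  apply: csmooth_local => q Vq; have [Uq|nUq] := pselect (U q).
    have oI := openI oV oU; exists (V `&` U); split=> //.
    apply: csmoothM => //; first by apply: csmooth_real; exact: smooth_fun_sub schi.
    apply: csmooth_sum => // a; apply: csmoothM => //; first exact: csmooth_cst.
    by apply: (vZ F a).2 => //; apply: csmooth_sub sf.
  exists (V `&` ~` K); split; [apply: openI => //; exact: closed_openC|by split=> // /KU|].
  apply: csmooth_ext (openI oV (closed_openC cK)) _ (csmooth_cst _ 0) => x [_ /chi0 /W0 ->] //.
have JW q : cplxJ q (W q) = scalev 'i%C (W q).
  have [Uq|/U0 ->] := pselect (U q); last first.
    by rewrite J0; apply/funext => f; rewrite /scalev /zerov mulr0.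
  have [_ linJ _] := cplxJ_structure M.
  have th0 := form0 (form_theta M) I (p := q).
  have thZ : theta q (sumv c (fun a => Z a q)) = 0.
    rewrite (form_sumv (form_theta M)) // => [|a]; last exact: (vZ F a).1.
    by rewrite big1 // => a _; rewrite theta_Z ?mulr0.
  have -> : W q = addv (scalev (chi q)%:C%C (sumv c (fun a => Z a q))) (@zerov _ _ M) by rewrite addv0.
  rewrite linJ // ?J0; [|exact: tS|exact: tangent0].
  suff -> : cplxJ q (sumv c (fun a => Z a q)) = scalev 'i%C (sumv c (fun a => Z a q)).
    by apply/funext => f; rewrite /addv /scalev /zerov; ring.
  (* J is linear only on horizontal tangent vectors, so the induction carries tangency and
     horizontality along. *)
  have [_] : tangent q (sumv c (fun a => Z a q)) /\
      cplxJ q (sumv c (fun a => Z a q)) = scalev 'i%C (sumv c (fun a => Z a q)) /\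
      theta q (sumv c (fun a => Z a q)) = 0; last by case.
  rewrite /sumv; elim: (index_enum _) => [|a r [t [IH th]]].
    rewrite (_ : (fun f => _) = @zerov _ _ M).
      split; [exact: tangent0|split=> //].
      by rewrite J0; apply/funext => f; rewrite /scalev /zerov mulr0.
    by apply/funext => f; rewrite big_nil.
  rewrite (_ : (fun f => _) = addv (scalev (c a) (Z a q)) (fun f => \sum_(j <- r) c j * Z j q f)).
    have [tZ thZa JZ] := Z_T10 F a Uq.
    split; first exact: tangent_lin.
    split; last by rewrite (form_lin (form_theta M)) // thZa th mulr0 addr0.
    rewrite linJ // JZ IH; apply/funext => f; rewrite /addv /scalev; ring.
  by apply/funext => f; rewrite big_cons.
have sW : section_T10 W by split=> // q _; split.
have Wp : W p = sumv c (fun a => Z a p).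
  by apply/funext => f; rewrite /W /scalev chip rmorph1 mul1r.
have thWp a : wth F a p (W p) = c a.
  rewrite Wp (form_sumv (form_th F a) Up) => [|b]; last exact: (vZ F b).1.
  by rewrite -[RHS](sum_delta c); apply: eq_bigr => b _; rewrite th_Z // eq_sym.
have := hRic sW oU F Up; rewrite /Ric.
under eq_bigr do under eq_bigr do rewrite !thWp.
suff -> : levi W W p = \sum_a c a * (c a)^*%C by [].
rewrite /levi /levi_form.
have thWb q : theta q (conjf W q) = 0 by rewrite /conjf theta_conj // thW conjc0.
have vWU := vfield_sub (@subsetT _ U) vW.
have vWbU := vfield_conj vWU.
have sc z : csmooth U (fun q => (chi q)%:C%C * z).
  apply: csmoothM => //; last exact: csmooth_cst.
  by apply: csmooth_real; exact: smooth_fun_sub schi.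
pose x a : A := restr oU (sc (c a)); pose y a : A := restr oU (sc (c a)^*%C).
have Wx (f : A) q : U q -> W q f = (\sum_a x a * fZ FA a f) q.
  move=> Uq; rewrite lf_sum // /W /scalev /sumv big_distrr; apply: eq_bigr => a _.
  by rewrite lfM // [x a q]restrE // -(@Z_val f f) //; exact: mulrA.
have Wy (f : A) q : U q -> conjf W q f = (\sum_a y a * fZb FA a f) q.
  move=> Uq; rewrite lf_sum // /conjf /conjv /W /scalev /sumv rmorphM rmorph_sum big_distrr.
  apply: eq_bigr => a _; rewrite lfM // [y a q]restrE // -(@Zb_val f f) // rmorphM.
  by rewrite -mulrA; congr (_ * _); exact: conjc_real.
(* The Levi form at p is i times the T-component of the bracket of W and conj W. Derivatives of chi
   affect only the horizontal components x' and y'. *)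
have [x' [y' Hb]] := frame_bracket FA x y.
have Hbr : bracket W (conjf W) p = comb F (- 'i%C * \sum_a c a * (c a)^*%C)
    (fun a => x' a p) (fun a => y' a p) p.
  apply: (tangent_ext (oU := oU) Up).
  - exact: (tangent_bracket oU).
  - exact: (tangent_comb hT).
  move=> f; rewrite (comb_lf hT F _ x' y') // -(lder_bracket vWU vWbU) //.
  have -> : lder vWU (lder vWbU f) = \sum_a x a * fZ FA a (\sum_c y c * fZb FA c f).
    apply: locfunP => q Uq; rewrite -Wx //; apply: lderE => // r Ur.
    by rewrite -Wy //; symmetry; apply: lderE.
  have -> : lder vWbU (lder vWU f) = \sum_c y c * fZb FA c (\sum_a x a * fZ FA a f).
    apply: locfunP => q Uq; rewrite -Wy //; apply: lderE => // r Ur.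
    by rewrite -Wx //; symmetry; apply: lderE.
  rewrite Hb lfB // lfD // !lfM // fi_val //.
  have -> : fpair x y p = \sum_a c a * (c a)^*%C.
    rewrite /fpair lf_sum //; apply: eq_bigr => a _.
    by rewrite lfM // [x a p]restrE // [y a p]restrE // chip rmorph1 !mul1r.
  by rewrite addrC !mulNr.
have := @dform_bracket _ _ M U oU (@theta R n M) W (conjf W) 0 0 p Up vWU vWbU (fun q _ => thW q) (fun q _ => thWb q).
rewrite Hbr (theta_comb hT F Up) => e.
rewrite -[dform _ _ _ _]opprK -e mulrNN mulrA mulrN -expr2 sqr_i; ring.
Qed.

End Cutoff.
End Translation.

(** * Real functions, and the inequality at a point *)

Section Main.
Variables (R : realType) (n : nat) (M : pseudohermitian R n) (T : cfield M).
Hypotheses (hT : reeb T) (htor : vanishing_torsion T).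
Variables (U : set M) (oU : open U) (F : webster_frame T U).
Local Notation C := R[i].
Local Notation A := (locfun oU).
Local Notation FA := (webster_algebra hT htor oU F).

Lemma lconjE (a : A) q : U q -> lconj a q = ((a q)^*)%C.
Proof. exact: restrE. Qed.

Lemma Z_lconj a (x : A) q : U q -> fZb FA a (lconj x) q = ((fZ FA a x q)^*)%C.
Proof. by move=> Uq; rewrite -lconjE // (lder_conj (vZ F a) (vZb F a)). Qed.

Lemma T_lconj (x : A) q : U q -> fT FA (lconj x) q = ((fT FA x q)^*)%C.
Proof.
move=> Uq; have eT : conjf T = T by apply/funext => r; exact: (conj_T hT).
have vTb : vfield U (conjf T) by rewrite eT; exact: (@vT _ _ _ _ hT U).
rewrite -lconjE // (lder_conj (@vT _ _ _ _ hT U) vTb); symmetry.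
rewrite /aT [LHS](lderE vTb Uq (fun _ _ => erefl)) eT.
by symmetry; apply: (lderE (@vT _ _ _ _ hT U) Uq).
Qed.

Section RealFunction.
Variables (f : A).
Hypothesis fr : lconj f = f.
Local Notation u := (grad10 FA f).
Local Notation v := (grad01 FA f).

Lemma grad01_conj a q : U q -> v a q = ((u a q)^*)%C.
Proof. by move=> Uq; rewrite /grad01 -{1}fr Z_lconj. Qed.

Lemma lconj_grad10 a : lconj (u a) = v a.
Proof. by apply: locfunP => q Uq; rewrite lconjE // grad01_conj. Qed.

Lemma lconj_grad01 a : lconj (v a) = u a.
Proof. by apply: locfunP => q Uq; rewrite lconjE // grad01_conj // conjcK. Qed.

Lemma fP_conj a b c q : U q -> ((fP FA a b c q)^*)%C = - fQ FA b a c q.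
Proof. by move=> Uq; rewrite fP_val // fQ_val // conjP. Qed.

Lemma fQ_conj a b c q : U q -> ((fQ FA a b c q)^*)%C = - fP FA b a c q.
Proof. by move=> Uq; rewrite fP_val // fQ_val // conjQ. Qed.

(** For real f, conjugation in the ring exchanges the gradients and their covariant derivatives, so
    the bilinear cross terms of the Bochner identity become squared norms. *)
Lemma nZb01_conj a b q : U q -> nZb01 FA b v a q = ((nZ FA b u a q)^*)%C.
Proof.
move=> Uq; rewrite /nZb01 /nZ /cov !lfB // !lf_sum // rmorphB rmorph_sum; congr (_ - _).
  by rewrite -(lconj_grad10 a); exact: Z_lconj.
apply: eq_bigr => c _; rewrite !lfM // rmorphM; congr (_ * _); last exact: grad01_conj.
rewrite [RHS]fP_conj // -[RHS]mulN1r; congr (_ * _); exact: restrE.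
Qed.

Lemma nZ01_conj a b q : U q -> nZ01 FA b v a q = ((nZb FA b u a q)^*)%C.
Proof.
move=> Uq; rewrite nZ01E /nZb /cov lfD // lfB // !lf_sum // rmorphB rmorph_sum.
rewrite -sumrN; congr (_ + _).
  by have := Z_lconj b (v a) Uq; rewrite lconj_grad01 => ->; exact: esym (conjcK _).
apply: eq_bigr => c _; rewrite !lfM // rmorphM -mulNr; congr (_ * _); last exact: grad01_conj.
by rewrite [X in - X]fQ_conj // opprK.
Qed.

End RealFunction.

End Main.

Theorem lemma3p1 (R : realType) (n : nat) (hn : (0 < n)%N)
    (M : pseudohermitian R n) (T : cfield M) (hT : reeb T)
    (htor : vanishing_torsion T)
    (k : R) (hk : 0 <= k) (hRic : ricci_lower_bound T k) :
  CD T (- k) (2 * n%:R) 4 (2 * n%:R).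
Proof.
move=> f0 sf0 nu nu0 U oU F p Up; cbv zeta.
set fC : M -> R[i] := fun q => (f0 q)%:C%C.
have sf : csmooth U fC by apply: csmooth_real; exact: smooth_fun_sub sf0.
pose FA := webster_algebra hT htor oU F; pose f := restr oU sf.
have ff x : U x -> fC x = f x by move=> Ux; rewrite [RHS]restrE.
have fr : lconj f = f.
  by apply: locfunP => x Ux; rewrite lconjE // -ff // /fC; exact: conjc_real.
pose t := fT FA f.
have tr : lconj t = t by apply: locfunP => x Ux; rewrite lconjE // -T_lconj // fr.
(* These equalities are needed on all of U and not only at p, since Gamma_2 and Gamma_2^Z
   differentiate them. *)
have tt x : U x -> GammaZ T fC fC x = (t * t) x.
  by move=> Ux; rewrite /GammaZ (T_val hT htor F ff Ux) lfM.
have LL x : U x -> opL F fC x = (sublap FA f *+ 2) x by move=> Ux; exact: opL_val.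
have GG x : U x -> Gamma F fC fC x = carre FA f f x by move=> Ux; exact: Gamma_val.
have G2 : Gamma2 F fC p = (sublap FA (carre FA f f) - carre FA f (sublap FA f) *+ 2) p.
  rewrite /Gamma2 (opL_val hT htor (oU := oU) F GG Up) (Gamma_val hT htor F ff LL Up).
  have -> : carre FA f (sublap FA f *+ 2) = carre FA f (sublap FA f) *+ 2 by rewrite mulr2n carreDr.
  by rewrite lfB // !lf_muln //; field.
have GZ2 : GammaZ2 F fC p = (sublap FA (t * t) - t * fT FA (sublap FA f) *+ 2) p.
  rewrite /GammaZ2 (opL_val hT htor (oU := oU) F tt Up) {1}/GammaZ.
  rewrite (T_val hT htor F ff Up) (T_val hT htor F LL Up).
  have -> : fT FA (sublap FA f *+ 2) = fT FA (sublap FA f) *+ 2 by rewrite mulr2n (derD _ _ (der_fT FA)).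
  rewrite lfB // !lf_muln // !lfM // ?lf_muln //.
  by rewrite -/t; field.
rewrite G2 GZ2 gamma2E gammaZ2E tt // LL // GG // -/t.
pose al a := grad10 FA f a p; pose be a := grad10 FA t a p.
pose h b a := nZ FA b (grad10 FA f) a p; pose ka b a := nZb FA b (grad10 FA f) a p.
pose r : R[i] := \sum_a \sum_c ric FA a c p * (al a)^*%C * al c.
have := @cd_ineq R n al be h ka (t p) r k nu hn nu0.
(* The coefficients are conjugated because the Bochner identity pairs the first Ricci index with v_a
   = conj(u_a). *)
have hr : - k%:C%C * (\sum_a al a * (al a)^*%C) <= 2 * r.
  have := ricci_bound hT htor oU F Up (fun a => (al a)^*%C) hRic.
  congr (_ * _ <= 2 * _).
    by apply: eq_bigr => a _; rewrite conjcK mulrC.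
  apply: eq_bigr => a _; apply: eq_bigr => c _.
  by rewrite conjcK (ricci_val hT htor oU F a c Up).
have ht : (t p)^*%C = t p by rewrite -lconjE // tr.
have fiE : fi FA p = 'i%C := fi_val hT htor oU F Up.
have EF a b : nZ01 FA b (grad01 FA f) a p = (ka b a)^*%C := nZ01_conj hT htor F fr a b Up.
have EbF a b : nZb01 FA b (grad01 FA f) a p = (h b a)^*%C := nZb01_conj hT htor F fr a b Up.
have hka a : ka a a - (ka a a)^*%C = 'i%C * t p.
  have e : ka a a = (nZ01 FA a (grad01 FA f) a + fi FA * t) p.
    by rewrite /ka hess_mixed eqxx mulr1.
  by rewrite {1}e [X in X - _]lfD // [X in _ + X - _]lfM // EF fiE addrC addKr.
move=> /(_ ht hka hr).
have vE a : grad01 FA f a p = (al a)^*%C by exact: grad01_conj.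
have wE a : grad01 FA t a p = (be a)^*%C by exact: grad01_conj.
have -> : (sublap FA f *+ 2) p = 2 * \sum_a (ka a a + (ka a a)^*%C).
  rewrite lf_muln // /sublap lf_sum // mulr_natl; congr (_ *+ 2); apply: eq_bigr => a _.
  by rewrite lfD // EF.
have -> : carre FA f f p = 4 * \sum_a al a * (al a)^*%C.
  rewrite /carre lf_sum // big_distrr; apply: eq_bigr => a _.
  rewrite lf_muln // lfD // !lfM // -[fZb FA a f p]/(grad01 FA f a p) vE -/(al a).
  by rewrite /al /grad10 -/FA /=; ring.
have -> : (t * t) p = t p ^+ 2 by rewrite lfM.
have -> : (fpair (grad10 FA t) (grad01 FA t) *+ 4) p = 4 * \sum_a be a * (be a)^*%C.
  rewrite lf_muln // /fpair lf_sum // mulr_natl; congr (_ *+ 4); apply: eq_bigr => a _.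
  by rewrite lfM // wE.
set lhs := (X in X <= _); move=> H; apply: le_trans H _.
rewrite le_eqVlt; apply/orP; left; apply/eqP; congr (_ + _).
rewrite lf_muln // !lfD // ?lf_muln // ?lfM // ?lfB // ?lfM // ?lfB // fiE.
have -> : (\sum_a \sum_c ric FA a c * grad01 FA f a * grad10 FA f c) p = r.
  rewrite lf_sum //; apply: eq_bigr => a _; rewrite lf_sum //; apply: eq_bigr => c _.
  by rewrite !lfM // vE.
have -> : fpair (grad01 FA f) (grad10 FA t) p = \sum_a (al a)^*%C * be a.
  by rewrite /fpair lf_sum //; apply: eq_bigr => a _; rewrite lfM // vE.
have -> : fpair (grad10 FA f) (grad01 FA t) p = \sum_a al a * (be a)^*%C.
  by rewrite /fpair lf_sum //; apply: eq_bigr => a _; rewrite lfM // wE.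
have -> : (\sum_i (fpair (nZ FA i (grad10 FA f)) (nZb01 FA i (grad01 FA f))
      + fpair (nZb FA i (grad10 FA f)) (nZ01 FA i (grad01 FA f))) *+ 2) p =
    2 * \sum_b (\sum_a h b a * (h b a)^*%C + \sum_a ka b a * (ka b a)^*%C).
  rewrite lf_sum // big_distrr; apply: eq_bigr => b _; rewrite lf_muln // lfD // [RHS]mulr_natl.
  by rewrite /fpair !lf_sum //; congr ((_ + _) *+ 2); apply: eq_bigr => a _;
    rewrite lfM // ?EbF ?EF.
ring.
Qed.
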